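(* (First variation of $I_{SR}$.) Let $\mathbb{G}$ be a Carnot group, let $x:[a,b]\to\mathbb{G}$ be a differentiable path, let $\vartheta:[a,b]\times]-\epsilon_0,\epsilon_0[\to\mathbb{G}$ be a differentiable variation of $x$, with $\vartheta_s=\vartheta(\cdot,s)$, and let $P_V=P_V(t,s)$ be the (vertical) Lagrange multiplier along $\vartheta$. Then $$\delta^1I_{SR}:=\frac{d}{ds}I_{SR}(\vartheta_s)\Big|_{s=0}=\Big\langle\partial_s\vartheta|_{s=0},\Big(\frac{\partial_tx}{|\partial_tx|},P_V\Big)\Big\rangle\Big|_a^b-\int_a^b\Big\{\Big\langle\partial_s\vartheta|_{s=0},\Big[\nabla_t\frac{\partial_tx}{|\partial_tx|}+\partial_tP_V+C(P_V)\partial_tx\Big]\Big\rangle-\langle\partial_sP_V|_{s=0},\partial_tx\rangle\Big\}\,dt .$$ Assume moreover that $|\partial_tx|=1$ and that $\vartheta$ is a homotopy of $x$. Setting $Y(t):=\partial_s\vartheta(t,0)$ and $Q_V(t):=\partial_sP_V(t,0)$, one has $$\delta^1I_{SR}=\int_a^b\Big\{\langle Q_V,\partial_tx\rangle-\Big\langle Y,\Big[\nabla_t\partial_tx+\partial_tP_V+C(P_V)\partial_tx\Big]\Big\rangle\Big\}\,dt .$$ (On the right-hand sides $P_V$ is evaluated at $s=0$.)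
   Context: A $k$-step Carnot group $\mathbb{G}$ is a connected, simply connected nilpotent Lie group of dimension $n$ whose Lie algebra is stratified: $\mathfrak{g}=H_1\oplus\dots\oplus H_k$, $[H_1,H_{i-1}]=H_i$ ($i=2,\dots,k$), $[H_1,H_k]=0$. Set $H=H_1$ (horizontal bundle), $V=H_2\oplus\dots\oplus H_k$ (vertical bundle), $h=\dim H$. Fix a left-invariant frame $X_1,\dots,X_n$ adapted to the stratification, with $X_1,\dots,X_h$ spanning $H$ and $X_{h+1},\dots,X_n$ spanning $V$, and the left-invariant Riemannian metric $\langle\cdot,\cdot\rangle$ making it orthonormal. For a curve $z:[a,b]\to\mathbb{G}$ and a vertical field $P_V=\sum_{\alpha>h}P_\alpha X_\alpha$ along it (the Lagrange multiplier), $I_{SR}(z)=\int_a^b\big(|\dot z_H|+\langle P_V,\dot z\rangle\big)dt$, where $\dot z_H$ is the orthogonal projection of $\dot z$ onto $H$; in $I_{SR}(\vartheta_s)$ one uses the multiplier $P_V(\cdot,s)$. A variation of $x$ is a smooth map $\vartheta:[a,b]\times]-\epsilon_0,\epsilon_0[\to\mathbb{G}$, $\epsilon_0>0$, with $\vartheta(t,0)=x(t)$ for all $t\in[a,b]$; it is a homotopy of $x$ if it fixes endpoints, i.e. $\vartheta(a,s)=x(a)$, $\vartheta(b,s)=x(b)$ for all $s$. ''Differentiable'' is understood as smooth, and $\partial_tx\neq0$ is understood wherever $\partial_tx/|\partial_tx|$ is written. $\nabla$ is the Levi-Civita connection and $\nabla_t$ is covariant differentiation along $x$. $\partial_tP_V$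 and $\partial_sP_V$ are the vertical fields obtained by differentiating the components $P_\alpha$ with respect to the frame. $(\frac{\partial_tx}{|\partial_tx|},P_V)$ denotes the vector $\frac{\partial_tx}{|\partial_tx|}+P_V$. With $C^R_{IJ}=\langle[X_I,X_J],X_R\rangle$ and $C^\alpha=[C^\alpha_{IJ}]_{I,J=1,\dots,n}$, $C(P_V)=\sum_{\alpha>h}P_\alpha C^\alpha$ acts on component vectors with respect to the frame.
   Formalization: The path x is additionally assumed horizontal (its velocity lies in H on [a,b]); for a non-horizontal path the formula fails, e.g. in the Heisenberg group with velocity (X1+X3)/√2 and P_V=0. The term with ∂_sP_V then vanishes. *)

(* Defs.v *)
From mathcomp Require Export all_boot all_order all_algebra.
From mathcomp Require Export all_classical all_reals all_analysis.

Set Implicit Arguments.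
Unset Strict Implicit.
Unset Printing Implicit Defensive.

Export Order.TTheory GRing.Theory Num.Theory.
Export numFieldNormedType.Exports.

#[global] Open Scope ring_scope.
#[global] Open Scope classical_set_scope.

(* All normed modules below are finite-dimensional, where this is the usual
   notion of a C^r map on an open set U. *)
Fixpoint Cr (R : realType) (V W : normedModType R) (r : nat) (U : set V)
    (f : V -> W) : Prop :=
  match r with
  | 0 => forall p, U p -> {for p, continuous f}
  | r'.+1 => (forall p, U p -> differentiable f p) /\
             (forall v : V, Cr r' U (fun p => 'd f p v))
  end.

(* A map is smooth on an arbitrary set A when it is smooth on some open set
   containing A.  Thus a smooth map on a set with boundary, such as `[a, b], is
   represented by a smooth extension of it; the derivatives of the extension at
   the boundary points are the one-sided derivatives. *)
Definition smooth_on (R : realType) (V W : normedModType R) (A : set V)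
    (f : V -> W) : Prop :=
  exists U : set V, [/\ open U, A `<=` U & forall r, Cr r U f].

Section VectorFields.
Variables (R : realType) (n : nat).
Local Notation T := 'rV[R]_n.

(* Every tangent space of R^n is identified with R^n, so that a vector field is
   a map T -> T; [X, Y] is the Lie bracket for which [X, Y]f = X(Yf) - Y(Xf). *)
Definition vf_bracket (X Y : T -> T) (p : T) : T :=
  'd Y p (X p) - 'd X p (Y p).

End VectorFields.

(* A connected, simply connected nilpotent Lie group is diffeomorphic to its Lie
   algebra through exp; the group is therefore given by a smooth group law on
   R^n.  Conversely R^n is connected and simply connected, and nilpotency
   follows from the stratification. *)
Record lieGroup (R : realType) (n : nat) := LieGroup {
  gmul : 'rV[R]_n -> 'rV[R]_n -> 'rV[R]_n;
  gone : 'rV[R]_n;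
  ginv : 'rV[R]_n -> 'rV[R]_n;
  gmulA : associative gmul;
  gmul1g : left_id gone gmul;
  gmulVg : left_inverse gone ginv gmul;
  gmul_smooth : smooth_on setT
    (fun pq : ('rV[R]_n * 'rV[R]_n)%type => gmul pq.1 pq.2);
  ginv_smooth : smooth_on setT ginv
}.

Section LieAlgebra.
Variables (R : realType) (n : nat) (G : lieGroup R n).
Local Notation T := 'rV[R]_n.

(* The left-invariant vector field with value v at the identity. *)
Definition lie_field (v : T) (p : T) : T := 'd (gmul G p) (gone G) v.

(* The Lie algebra of left-invariant fields, carried by the tangent space at the
   identity. *)
Definition lie_bracket (u v : T) : T :=
  vf_bracket (lie_field u) (lie_field v) (gone G).

(* The span of all [u, v] with u in U and v in W; by bilinearity it is enough to
   take the brackets of the elements of bases. *)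
Definition bracket_space (U W : {vspace T}) : {vspace T} :=
  <<[seq lie_bracket u v | u <- vbasis U, v <- vbasis W]>>%VS.

End LieAlgebra.

(* The layers are numbered from 1 to step; the other values of layer play no
   role. *)
Record carnotGroup (R : realType) (n : nat) := CarnotGroup {
  carnot_lie :> lieGroup R n;
  step : nat;
  layer : nat -> {vspace 'rV[R]_n};
  step_gt0 : (0 < step)%N;
  layer_full : (\sum_(i < step) layer i.+1 = fullv)%VS;
  layer_direct : directv (\sum_(i < step) layer i.+1)%VS;
  layer_bracket : forall i, (2 <= i <= step)%N ->
    bracket_space carnot_lie (layer 1) (layer i.-1) = layer i;
  layer_last : bracket_space carnot_lie (layer 1) (layer step) = 0%VS
}.

Section CarnotGeometry.
Variables (R : realType) (n : nat) (G : carnotGroup R n).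
Local Notation T := 'rV[R]_n.

Definition hdim : nat := \dim (layer G 1).

(* The frame is given by its values E at the identity: consecutive blocks of E
   are bases of H_1, H_2, etc. *)
Definition adapted_frame (E : n.-tuple T) : Prop :=
  basis_of fullv E /\
  forall i, (0 < i <= step G)%N ->
    basis_of (layer G i)
      [seq E`_j | j <- iota (\sum_(1 <= l < i) \dim (layer G l))
                            (\dim (layer G i))].

Variable E : n.-tuple T.

Definition frame (i : 'I_n) : T -> T := lie_field G (tnth E i).

Definition comp (p u : T) (i : 'I_n) : R :=
  coord [tuple frame j p | j < n] i u.

(* The Riemannian metric making the frame orthonormal. *)
Definition metric (p u v : T) : R := \sum_(i < n) comp p u i * comp p v i.

Definition rnorm (p u : T) : R := Num.sqrt (metric p u u).

Definition hproj (p u : T) : T :=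
  \sum_(i < n | (i < hdim)%N) metric p u (frame i p) *: frame i p.

(* Only the vertical components of P are used. *)
Definition vfield (P : 'I_n -> R) (p : T) : T :=
  \sum_(i < n | (hdim <= i)%N) P i *: frame i p.

(* C^r_ij = <[X_i, X_j], X_r>, a constant function on G, taken at the
   identity. *)
Definition struct_const (r i j : 'I_n) : R :=
  let e := gone G in metric e (vf_bracket (frame i) (frame j) e) (frame r e).

Definition Cmat (P : 'I_n -> R) : 'M[R]_n :=
  \sum_(al < n | (hdim <= al)%N) P al *: \matrix_(i, j) struct_const al i j.

(* The tangent vector at p whose components are the product of the matrix
   C(P_V) and the column of components of u. *)
Definition Cact (P : 'I_n -> R) (p u : T) : T :=
  \sum_(i < n) (Cmat P *m (\col_j comp p u j)) i 0 *: frame i p.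

Record levi_civita (nabla : (T -> T) -> (T -> T) -> (T -> T)) : Prop :=
  LeviCivita {
  nabla_smooth : forall X Y, smooth_on setT X -> smooth_on setT Y ->
    smooth_on setT (nabla X Y);
  nabla_linl : forall (f : T -> R) X Y Z, smooth_on setT f ->
    smooth_on setT X -> smooth_on setT Y -> smooth_on setT Z ->
    forall p, nabla (fun q => f q *: X q + Y q) Z p =
              f p *: nabla X Z p + nabla Y Z p;
  nabla_addr : forall X Y Z,
    smooth_on setT X -> smooth_on setT Y -> smooth_on setT Z ->
    forall p, nabla X (fun q => Y q + Z q) p = nabla X Y p + nabla X Z p;
  nabla_leibniz : forall (f : T -> R) X Y, smooth_on setT f ->
    smooth_on setT X -> smooth_on setT Y ->
    forall p, nabla X (fun q => f q *: Y q) p =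
              'd f p (X p) *: Y p + f p *: nabla X Y p;
  nabla_torsion_free : forall X Y, smooth_on setT X -> smooth_on setT Y ->
    forall p, nabla X Y p - nabla Y X p = vf_bracket X Y p;
  nabla_metric : forall X Y Z,
    smooth_on setT X -> smooth_on setT Y -> smooth_on setT Z ->
    forall p, 'd (fun q => metric q (Y q) (Z q)) p (X p) =
              metric p (nabla X Y p) (Z p) + metric p (Y p) (nabla X Z p)
}.

(* Covariant derivative along x of a field W along x, in the standard
   coordinates of R^n: the constant fields are the coordinate fields, so this is
   dW^k/dt + Gamma^k_ij x'^i W^j. *)
Definition cov_deriv (nabla : (T -> T) -> (T -> T) -> (T -> T))
    (x W : R -> T) (t : R) : T :=
  derive1 W t + nabla (cst (derive1 x t)) (cst (W t)) (x t).

Definition unit_tangent (x : R -> T) (t : R) : T :=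
  (rnorm (x t) (derive1 x t))^-1 *: derive1 x t.

Definition I_SR (a b : R) (z : R -> T) (P : 'I_n -> R -> R) : R :=
  \int[lebesgue_measure]_(t in `[a, b])
    (rnorm (z t) (hproj (z t) (derive1 z t)) +
     metric (z t) (vfield (P ^~ t) (z t)) (derive1 z t)).

(* For a path which is not horizontal the first variation of the integral of
   |z'_H| involves x'_H / |x'_H| instead of x' / |x'|, and it need not exist
   where x'_H vanishes. *)
Definition horizontal_on (a b : R) (x : R -> T) : Prop :=
  forall t, t \in `[a, b]%R -> hproj (x t) (derive1 x t) = derive1 x t.

Definition strip (a b eps : R) : set (R * R)%type :=
  `[a, b] `*` `]- eps, eps[.

Definition variation (a b eps : R) (x : R -> T) (theta : R -> R -> T) : Prop :=
  smooth_on (strip a b eps) (fun ts => theta ts.1 ts.2) /\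
  forall t, t \in `[a, b]%R -> theta t 0 = x t.

Definition homotopy_of (a b eps : R) (x : R -> T) (theta : R -> R -> T) : Prop :=
  variation a b eps x theta /\
  forall s, s \in `]- eps, eps[%R -> theta a s = x a /\ theta b s = x b.

End CarnotGeometry.

(* Main.v *)
From HB Require Import structures.
From mathcomp Require Import ring.
Require Import Defs.

(** In the left-invariant frame [X], let [a_k] and [y_k] be the components of
    [theta_t] and [theta_s].  Symmetry of second derivatives gives
    [d_s a_k = d_t y_k + sum_ij a_i y_j C^k_ij].  At [s = 0] the path is
    horizontal, and [C^k_ij = 0] for horizontal [k] and [i], because
    [[H_1, H_l]] lies in [H_(l+1)].  So only the vertical components of
    [d_s theta_t] see the structure constants; they produce the term [C(P_V)].
    Differentiating the integrand in [s] and integrating [d_t y_k] by parts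
    gives the formula with the ordinary derivatives of the components of
    [x'/|x'|].  These are the components of the covariant derivative: the
    Christoffel correction is [sum_ij x'_i x'_j <nabla_(X_j) X_i, X_k>] up to a
    factor, which vanishes for horizontal [x'] by the Koszul identities. *)

Set Implicit Arguments.
Unset Strict Implicit.
Unset Printing Implicit Defensive.

(** * Closure properties of C^r and smooth maps *)

Section SmoothCalculus.
Variables (R : realType).
Implicit Types (V W : normedModType R) (r : nat).

(** The norm of the horizontal velocity is smooth only where that velocity is nonzero. Horizontality
    and regularity of [x] guarantee this on the segment [s = 0] and nowhere else, so the variation
    is studied on a neighbourhood of [[a, b] x {0}]; compactness of [[a, b]] then yields a strip of
    uniform width on which the integral can be differentiated. [Cr] controls differentials in fixed
    directions only. Whenever the base point and the direction move together, as in the chain rule,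
    in left-invariant fields and in components, the direction is expanded in a basis first. A path
    on [[a, b]] is the restriction of a smooth map defined nearby, and two such maps that agree on
    [[a, b]] may differ outside; their derivatives at [a] and [b] have to be compared through
    one-sided limits. [nabla] is an arbitrary operator subject to axioms on globally smooth fields,
    and [cov_deriv] applies it to constant fields. Its relation to the frame comes from expanding
    constant fields in the frame, with variable coefficients. The pairing of [Q_V] with [x']
    vanishes, one being vertical and the other horizontal. *)

(** A little-o expansion at [p] sees only a neighbourhood of [p], so the expansion of [f] serves for
    [g], and uniqueness of the differential identifies the two. *)
Lemma near_eq_diff V W (f g : V -> W) (p : V) :
  {near p, f =1 g} -> differentiable f p ->
  differentiable g p /\ 'd g p = 'd f p :> (V -> W).
Proof.
move=> fg /diff_locallyP[cdf df].
have fgp : f p = g p by exact: nbhs_singleton fg.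
have dg : g \o shift p = cst (g p) + 'd f p +o_ (0 : V) id.
  apply/eqaddoP => e e0; move/eqaddoP : df => /(_ e e0).
  have : \forall h \near (0 : V), f (h + p) = g (h + p).
    by move: fg; rewrite (near_shift (0 : V) p) subr0.
  by apply: filterS2 => h /= fgh; rewrite /= !fctE /= fgh fgp.
have e : 'd g p = 'd f p :> (V -> W) by exact: diff_unique.
split; last exact: e.
apply/diff_locallyP; split; first by rewrite [X in continuous X]e.
exact: (eq_ind_r
  (fun d : V -> W => g \o shift p = cst (g p) + d +o_ (0 : V) id) dg e).
Qed.

Lemma CrW V W r (U : set V) (f : V -> W) : Cr r.+1 U f -> Cr r U f.
Proof.
elim: r f => [|r ih] f.
  by move=> [df _] p Up; apply: differentiable_continuous; exact: df.
by move=> [df ddf]; split => // v; apply: ih; exact: ddf.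
Qed.

Lemma Cr_subset V W r (U U' : set V) (f : V -> W) :
  U' `<=` U -> Cr r U f -> Cr r U' f.
Proof.
move=> U'U; elim: r f => [|r ih] f; first by move=> cf p /U'U; exact: cf.
by move=> [df ddf]; split => [p /U'U|v]; [exact: df|apply/ih/ddf].
Qed.

(** Openness of [U] turns equality on [U] into equality near each of its points, which passes to the
    differentials. *)
Lemma eq_Cr V W r (U : set V) (f g : V -> W) :
  open U -> (forall p, U p -> f p = g p) -> Cr r U f -> Cr r U g.
Proof.
move=> oU.
have nearU p (h k : V -> W) : U p -> (forall p, U p -> h p = k p) ->
    {near p, h =1 k}.
  by move=> Up hk; apply: filterS (open_nbhs_nbhs (conj oU Up)).
elim: r f g => [|r ih] f g fg.
  move=> cf p Up; have := cf p Up; rewrite /prop_for /continuous_at -fg//.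
  by apply: cvg_trans; apply: near_eq_cvg; exact: nearU.
move=> [df ddf]; split=> [p Up|v].
  by have [] := near_eq_diff (nearU _ _ _ Up fg) (df p Up).
apply: ih (ddf v) => p Up.
by have [_ ->] := near_eq_diff (nearU _ _ _ Up fg) (df p Up).
Qed.

(** Introduction rule behind the closure lemmas: the differential may be replaced by an explicit
    formula valid on [U] only. *)
Lemma CrS V W r (U : set V) (f : V -> W) (df : V -> V -> W) : open U ->
  (forall p, U p -> is_diff p f (df p)) ->
  (forall v, Cr r U (df ^~ v)) -> Cr r.+1 U f.
Proof.
move=> oU dfU Cdf; split=> [p Up|v]; first by case: (dfU p Up).
by apply: eq_Cr (Cdf v) => // p Up; case: (dfU p Up) => _ ->.
Qed.

Lemma Cr_cst V W r (U : set V) (c : W) : Cr r U (cst c).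
Proof.
elim: r c => [|r ih] c; first by move=> p _; exact: cst_continuous.
split=> [p _|v]; first exact: differentiable_cst.
rewrite (_ : (fun p => _) = cst 0) //; apply/funext => p.
by rewrite diff_cst.
Qed.

Lemma CrD V W r (U : set V) (f g : V -> W) : open U ->
  Cr r U f -> Cr r U g -> Cr r U (fun p => f p + g p).
Proof.
move=> oU; elim: r f g => [|r ih] f g.
  by move=> cf cg p Up; apply: continuousD; [exact: cf|exact: cg].
move=> [df ddf] [dg ddg].
apply: (@CrS _ _ _ _ _ (fun p v => 'd f p v + 'd g p v)) => // [p Up|v].
  exact: (is_diffD (differentiableP (df p Up)) (differentiableP (dg p Up))).
by apply: ih; [exact: ddf|exact: ddg].
Qed.

Lemma Cr_sum V W r (U : set V) (I : Type) (s : seq I) (P : pred I)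
  (F : I -> V -> W) : open U ->
  (forall i, P i -> Cr r U (F i)) -> Cr r U (fun p => \sum_(i <- s | P i) F i p).
Proof.
move=> oU CF; elim: s => [|i s ih].
  apply: (@eq_Cr _ _ _ _ (cst 0)) => //; last exact: Cr_cst.
  by move=> p _; rewrite big_nil.
case: (boolP (P i)) => Pi.
  apply: (@eq_Cr _ _ _ _ (fun p => F i p + \sum_(i <- s | P i) F i p)) => //.
    by move=> p _; rewrite big_cons Pi.
  by apply: CrD => //; exact: CF.
by apply: eq_Cr ih => // p _; rewrite big_cons (negbTE Pi).
Qed.

Lemma Cr_linl V W (W' : normedModType R) r (U : set V) (l : {linear W -> W'})
  (f : V -> W) : open U -> continuous l -> Cr r U f -> Cr r U (fun p => l (f p)).
Proof.
move=> oU cl; elim: r f => [|r ih] f.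
  by move=> cf p Up; apply: (@continuous_comp _ _ _ f l); [exact: cf|exact: cl].
move=> [df ddf].
apply: (@CrS _ _ _ _ _ (fun p v => l ('d f p v))) => // [p Up|v]; last first.
  by apply: ih; exact: ddf.
have dl : differentiable l (f p) by exact: linear_differentiable.
split; first by apply: (@differentiable_comp _ _ _ _ f l) => //; exact: df.
by rewrite (@diff_comp _ _ _ _ f l) ?diff_lin//; exact: df.
Qed.

(** Precomposing with an affine map sends the fixed direction [v] to the fixed direction [l v], so
    the induction closes without a product rule and in arbitrary normed modules. *)
Lemma Cr_affr (V' V W : normedModType R) r (U : set V) (l : {linear V' -> V})
  (c : V) (f : V -> W) : open U -> continuous l -> Cr r U f ->
  Cr r ((fun p => l p + c) @^-1` U) (fun p => f (l p + c)).
Proof.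
move=> oU cl.
have ca : continuous (fun p => l p + c).
  by move=> p; apply: continuousD; [exact: cl|exact: cst_continuous].
elim: r f => [|r ih] f.
  move=> cf p Up; apply: (@continuous_comp _ _ _ (fun p => l p + c) f).
    exact: ca.
  exact: cf.
move=> [df ddf].
have dl p : is_diff p (fun p => l p + c) l.
  apply: is_diff_eq.
    exact: (is_diffD (differentiableP (linear_differentiable p cl))
                     (is_diff_cst c p)).
  by rewrite addr0 diff_lin.
apply: (@CrS _ _ _ _ _ (fun p v => 'd f (l p + c) (l v))) => [|p Up|v].
- by apply: open_comp => // p _; exact: ca.
- have [dlp elp] := dl p.
  split.
    by apply: (@differentiable_comp _ _ _ _ (fun p => l p + c) f) => //; exact: df.
  by rewrite (@diff_comp _ _ _ _ (fun p => l p + c) f) ?elp//; exact: df.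
- exact: (ih _ (ddf (l v))).
Qed.

Lemma CrM V r (U : set V) (f g : V -> R) : open U ->
  Cr r U f -> Cr r U g -> Cr r U (fun p => f p * g p).
Proof.
move=> oU; elim: r f g => [|r ih] f g.
  by move=> cf cg p Up; apply: continuousM; [exact: cf|exact: cg].
move=> Cf Cg; move: (Cf) (Cg) => [df ddf] [dg ddg].
apply: (@CrS _ _ _ _ _ (fun p v => f p * 'd g p v + g p * 'd f p v)) => // [p Up|v].
  exact: (is_diffM (differentiableP (df p Up)) (differentiableP (dg p Up))).
by apply: CrD => //; apply: ih; [exact: CrW|exact: ddg|exact: CrW|exact: ddf].
Qed.

(** The derivative of [1 / f] is [- df / f^2]: order [r] for [1 / f] itself gives order [r.+1], so
    [f] stays fixed in the induction. The square root below is treated in the same way. *)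
Lemma CrV V r (U : set V) (f : V -> R) : open U -> (forall p, U p -> f p != 0) ->
  Cr r U f -> Cr r U (fun p => (f p)^-1).
Proof.
move=> oU f0; elim: r => [|r ih].
  by move=> cf p Up; apply: continuousV; [exact: f0|exact: cf].
move=> Cf; move: (Cf) => [df ddf].
have ihf := ih (CrW Cf).
apply: (@CrS _ _ _ _ _
  (fun p v => ((- 1) * ((f p)^-1 * (f p)^-1)) * 'd f p v)) => // [p Up|v].
  split; first by apply: differentiableV; [exact: df|exact: f0].
  rewrite diffV //; [|exact: df|exact: f0].
  by apply/funext => v /=; rewrite mulN1r -exprVn expr2.
apply: CrM => //; last exact: ddf.
by apply: CrM => //; [exact: Cr_cst|exact: CrM].
Qed.

Lemma Cr_sqrt V r (U : set V) (f : V -> R) : open U -> (forall p, U p -> 0 < f p) ->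
  Cr r U f -> Cr r U (fun p => Num.sqrt (f p)).
Proof.
move=> oU f0; elim: r => [|r ih].
  move=> cf p Up; apply: (@continuous_comp _ _ _ f Num.sqrt); first exact: cf.
  exact: sqrt_continuous.
move=> Cf; move: (Cf) => [df ddf].
have ihf := ih (CrW Cf).
apply: (@CrS _ _ _ _ _
  (fun p v => (2 * Num.sqrt (f p))^-1 * 'd f p v)) => // [p Up|v].
  have [ds es] := is_derive1_sqrt (f0 p Up).
  have dsq : differentiable (@Num.sqrt R) (f p) by exact/derivable1_diffP.
  split; first by apply: differentiable_comp => //; exact: df.
  rewrite [LHS](diff_comp (df p Up) dsq).
  apply/funext => v /=; rewrite [LHS](congr1 (fun h => h _) (diff1E dsq)) derive1E es.
  exact: mulrC.
apply: CrM => //; last exact: ddf.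
apply: CrV => //.
  by move=> p Up; rewrite mulf_neq0// gt_eqF// sqrtr_gt0 f0.
by apply: CrM => //; exact: Cr_cst.
Qed.

Lemma Cr_coord V r m n (U : set V) (f : V -> 'M[R]_(m, n)) i j : open U ->
  Cr r U f -> Cr r U (fun p => f p i j).
Proof.
move=> oU Cf.
have lin : linear (fun M : 'M[R]_(m, n) => M i j) by move=> a u w; rewrite !mxE.
pose lM := GRing.isLinear.Build _ _ _ _ _ lin.
pose l : {linear 'M[R]_(m, n) -> R} := HB.pack (fun M : 'M[R]_(m, n) => M i j) lM.
apply: (@Cr_linl _ _ _ r U l f) => //.
exact: coord_continuous.
Qed.

Lemma CrZl V W r (U : set V) (k : V -> R) (w : W) : open U ->
  Cr r U k -> Cr r U (fun p => k p *: w).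
Proof.
move=> oU Ck.
have lin : linear (fun c : R => c *: w).
  by move=> a u v; rewrite scalerDl scalerA.
pose lM := GRing.isLinear.Build _ _ _ _ _ lin.
pose l : {linear R -> W} := HB.pack (fun c : R => c *: w) lM.
apply: (@Cr_linl _ _ _ r U l k) => //.
exact: scalel_continuous.
Qed.

(** In the chain rule the direction ['d g p v] depends on [p], whereas [Cr] speaks of fixed
    directions. With a row space in the middle the direction is expanded in the standard basis, and
    the sum and product rules apply. *)
Lemma Cr_comp_rV V n r (U : set V) (O : set 'rV[R]_n) (f : 'rV[R]_n -> R)
    (g : V -> 'rV[R]_n) : open U -> open O -> (forall p, U p -> O (g p)) ->
  Cr r U g -> Cr r O f -> Cr r U (fun p => f (g p)).
Proof.
move=> oU oO gO; elim: r f => [|r ih] f.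
  move=> cg cf p Up; apply: (@continuous_comp _ _ _ g f); first exact: cg.
  by apply: cf; exact: gO.
move=> Cg; move: (Cg) => [dg ddg] [df ddf].
apply: (@CrS _ _ _ _ _
    (fun p v => \sum_(j < n) 'd g p v 0 j * 'd f (g p) (delta_mx 0 j))) => // [p Up|].
  split; first by apply: differentiable_comp; [exact: dg|by apply/df/gO].
  rewrite (@diff_comp _ _ _ _ g) //; [|exact: dg|by apply/df/gO].
  apply/funext => v /=.
  rewrite {1}[in LHS](row_sum_delta ('d g p v)) linear_sum /=.
  by apply: eq_bigr => j _; rewrite linearZ.
move=> v; apply: Cr_sum => // j _; apply: CrM => //.
  2: exact: (ih (fun q => 'd f q (delta_mx 0 j)) (CrW Cg) (ddf _)).
exact: (Cr_coord _ _ oU (ddg v)).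
Qed.

Lemma open_setI_preimage V W (U : set V) (f : V -> W) (O : set W) : open U ->
  open O -> (forall p, U p -> {for p, continuous f}) -> open (U `&` f @^-1` O).
Proof.
move=> oU oO cf; rewrite openE => p [Up Op]; apply: filterI.
  exact: open_nbhs_nbhs.
by apply: cf => //; exact: open_nbhs_nbhs.
Qed.

Lemma smooth_on_subset V W (A B : set V) (f : V -> W) :
  A `<=` B -> smooth_on B f -> smooth_on A f.
Proof. by move=> AB [U [oU BU Cf]]; exists U; split => // p /AB /BU. Qed.

Lemma smooth_on_differentiable V W (A : set V) (f : V -> W) p :
  smooth_on A f -> A p -> differentiable f p.
Proof. by move=> [U [oU AU /(_ 1%N)[df _]]] /AU; exact: df. Qed.

Lemma smooth_on_continuous V W (A : set V) (f : V -> W) p :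
  smooth_on A f -> A p -> {for p, continuous f}.
Proof. by move=> [U [oU AU /(_ 0%N)]] h /AU; exact: h. Qed.

Lemma smooth_on_near V W (A : set V) (f : V -> W) p :
  smooth_on A f -> A p -> \forall q \near p, differentiable f q.
Proof.
move=> [U [oU AU /(_ 1%N)[df _]]] /AU Up.
by apply: filterS (open_nbhs_nbhs (conj oU Up)) => q; exact: df.
Qed.

Lemma smooth_on_diff V W (A : set V) (f : V -> W) v :
  smooth_on A f -> smooth_on A (fun p => 'd f p v).
Proof.
move=> [U [oU AU Cf]]; exists U; split => // r.
by have [_] := Cf r.+1; apply.
Qed.

Lemma eq_smooth_on V W (A : set V) (f g : V -> W) :
  f =1 g -> smooth_on A f -> smooth_on A g.
Proof. by move=> /funext->. Qed.

Lemma smooth_on_cst V W (A : set V) (c : W) : smooth_on A (cst c).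
Proof. by exists setT; split=> // [|r]; [exact: openT|exact: Cr_cst]. Qed.

Lemma smooth_on_id V (A : set V) : smooth_on A (id : V -> V).
Proof.
exists setT; split=> // [|r]; first exact: openT.
elim: r => [p _|r _]; first exact: cvg_id.
apply: (CrS (df := fun p v => v) openT) => v; exact: Cr_cst.
Qed.

Lemma smooth_on2 V W (W' W'' : normedModType R) (A : set V) (f : V -> W)
  (g : V -> W') (h : V -> W'') :
  (forall (U : set V) r, open U -> Cr r U f -> Cr r U g -> Cr r U h) ->
  smooth_on A f -> smooth_on A g -> smooth_on A h.
Proof.
move=> H [U [oU AU Cf]] [U' [oU' AU' Cg]]; exists (U `&` U').
split; [exact: openI|by move=> p Ap; split; [exact: AU|exact: AU']|move=> r].
apply: H; first exact: openI.
- by apply: Cr_subset (Cf r) => p [].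
- by apply: Cr_subset (Cg r) => p [].
Qed.

Lemma smooth_onD V W (A : set V) (f g : V -> W) :
  smooth_on A f -> smooth_on A g -> smooth_on A (fun p => f p + g p).
Proof. by apply: smooth_on2 => U r; exact: CrD. Qed.

Lemma smooth_onM V (A : set V) (f g : V -> R) :
  smooth_on A f -> smooth_on A g -> smooth_on A (fun p => f p * g p).
Proof. by apply: smooth_on2 => U r; exact: CrM. Qed.

Lemma smooth_on_sum V W (A : set V) (I : Type) (s : seq I) (P : pred I)
  (F : I -> V -> W) : (forall i, P i -> smooth_on A (F i)) ->
  smooth_on A (fun p => \sum_(i <- s | P i) F i p).
Proof.
move=> sF; elim: s => [|i s ih].
  apply: (@eq_smooth_on _ _ _ (cst (0 : W))); last exact: smooth_on_cst.
  by move=> p; rewrite big_nil.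
have [Pi|Pi] := boolP (P i).
  apply: (@eq_smooth_on _ _ _ (fun p => F i p + \sum_(i <- s | P i) F i p)).
    by move=> p; rewrite big_cons Pi.
  by apply: smooth_onD => //; exact: sF.
by apply: eq_smooth_on ih => p; rewrite big_cons (negbTE Pi).
Qed.

Lemma smooth_on_prod V (A : set V) (I : Type) (s : seq I) (P : pred I)
  (F : I -> V -> R) : (forall i, P i -> smooth_on A (F i)) ->
  smooth_on A (fun p => \prod_(i <- s | P i) F i p).
Proof.
move=> sF; elim: s => [|i s ih].
  apply: (@eq_smooth_on _ _ _ (cst (1 : R))); last exact: smooth_on_cst.
  by move=> p; rewrite big_nil.
have [Pi|Pi] := boolP (P i).
  apply: (@eq_smooth_on _ _ _ (fun p => F i p * \prod_(i <- s | P i) F i p)).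
    by move=> p; rewrite big_cons Pi.
  by apply: smooth_onM => //; exact: sF.
by apply: eq_smooth_on ih => p; rewrite big_cons (negbTE Pi).
Qed.

(** Nonvanishing is required on [A] alone: by continuity the open neighbourhood shrinks to the
    points where [f] is nonzero. *)
Lemma smooth_onV V (A : set V) (f : V -> R) : (forall p, A p -> f p != 0) ->
  smooth_on A f -> smooth_on A (fun p => (f p)^-1).
Proof.
move=> f0 [U [oU AU Cf]]; exists (U `&` f @^-1` [set y | y != 0]).
have oU' : open (U `&` f @^-1` [set y | y != 0]).
  exact: (open_setI_preimage oU (@open_neq _ 0) (Cf 0%N)).
split=> // [p Ap|r]; first by split; [exact: AU|exact: f0].
by apply: CrV => // [p []//|]; apply: Cr_subset (Cf r) => p [].
Qed.

Lemma smooth_on_sqrt V (A : set V) (f : V -> R) : (forall p, A p -> 0 < f p) ->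
  smooth_on A f -> smooth_on A (fun p => Num.sqrt (f p)).
Proof.
move=> f0 [U [oU AU Cf]]; exists (U `&` f @^-1` [set y | 0 < y]).
have oU' : open (U `&` f @^-1` [set y | 0 < y]).
  exact: (open_setI_preimage oU (@open_gt _ 0) (Cf 0%N)).
split=> // [p Ap|r]; first by split; [exact: AU|exact: f0].
by apply: Cr_sqrt => // [p []//|]; apply: Cr_subset (Cf r) => p [].
Qed.

Lemma smooth_on_coord V m n (A : set V) (f : V -> 'M[R]_(m, n)) i j :
  smooth_on A f -> smooth_on A (fun p => f p i j).
Proof. by move=> [U [oU AU Cf]]; exists U; split=> // r; exact: Cr_coord. Qed.

Lemma smooth_onZl V W (A : set V) (k : V -> R) (w : W) :
  smooth_on A k -> smooth_on A (fun p => k p *: w).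
Proof. by move=> [U [oU AU Cf]]; exists U; split=> // r; exact: CrZl. Qed.

Lemma smooth_on_rV V n (A : set V) (f : V -> 'rV[R]_n) :
  (forall j, smooth_on A (fun p => f p 0 j)) -> smooth_on A f.
Proof.
move=> sf.
rewrite (_ : f = fun p => \sum_(j < n) f p 0 j *: delta_mx 0 j).
  by apply: smooth_on_sum => j _; exact: smooth_onZl.
by apply/funext => p; rewrite -row_sum_delta.
Qed.

Lemma smooth_onZ V n (A : set V) (k : V -> R) (f : V -> 'rV[R]_n) :
  smooth_on A k -> smooth_on A f -> smooth_on A (fun p => k p *: f p).
Proof.
move=> sk sf; apply: smooth_on_rV => j.
under eq_fun do rewrite mxE; apply: smooth_onM => //.
exact: smooth_on_coord.
Qed.

Lemma smooth_on_det V n (A : set V) (M : V -> 'M[R]_n) :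
  (forall i j, smooth_on A (fun p => M p i j)) -> smooth_on A (fun p => \det (M p)).
Proof.
move=> sM; apply: smooth_on_sum => s _.
by apply: smooth_onM; [exact: (@smooth_on_cst _ R)|exact: smooth_on_prod].
Qed.

(** Cramer's rule: the entries of the inverse are cofactors divided by the determinant. *)
Lemma smooth_on_invmx V n (A : set V) (M : V -> 'M[R]_n) i j :
  (forall p, M p \in unitmx) -> (forall i j, smooth_on A (fun p => M p i j)) ->
  smooth_on A (fun p => invmx (M p) i j).
Proof.
move=> uM sM; rewrite /invmx; under eq_fun do rewrite uM !mxE.
apply: smooth_onM.
  apply: smooth_onV; last exact: smooth_on_det.
  by move=> p _; rewrite -unitfE -unitmxE.
apply: smooth_onM; first exact: (@smooth_on_cst _ R).
by apply: smooth_on_det => i' j'; under eq_fun do rewrite !mxE; exact: sM.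
Qed.

Lemma smooth_on_affr (V' V W : normedModType R) (l : {linear V' -> V}) (c : V)
  (A : set V) (f : V -> W) : continuous l -> smooth_on A f ->
  smooth_on ((fun p => l p + c) @^-1` A) (fun p => f (l p + c)).
Proof.
move=> cl [U [oU AU Cf]]; exists ((fun p => l p + c) @^-1` U).
split=> [|p /AU //|r]; last exact: Cr_affr.
apply: open_comp => // p _; apply: continuousD; [exact: cl|exact: cst_continuous].
Qed.

Lemma smooth_on_comp V n (A : set V) (B : set 'rV[R]_n) (f : 'rV[R]_n -> R)
    (g : V -> 'rV[R]_n) : (forall p, A p -> B (g p)) ->
  smooth_on A g -> smooth_on B f -> smooth_on A (fun p => f (g p)).
Proof.
move=> AB [U [oU AU Cg]] [U' [oU' BU' Cf]].
have oUU' : open (U `&` g @^-1` U').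
  exact: (open_setI_preimage oU oU' (Cg 0%N)).
exists (U `&` g @^-1` U'); split=> // [p Ap|r].
  by split; [exact: AU|apply/BU'/AB].
apply: (@Cr_comp_rV _ _ _ _ U') => // [p []//|].
by apply: Cr_subset (Cg r) => p [].
Qed.

End SmoothCalculus.

(** * Symmetry of second derivatives *)

Section Schwarz.
Variables (R : realType) (V : normedModType R).
Implicit Types (f g : V -> R) (p u v : V).

Lemma is_derive_line g u c (x : R) : differentiable g (x *: u + c) ->
  is_derive x 1 (fun x : R => g (x *: u + c)) ('d g (x *: u + c) u).
Proof.
move=> dg.
have [dl el] : is_diff x (fun x : R => x *: u + c) (fun k => k *: u).
  by apply: is_diff_eq; rewrite addr0.
have dgl : differentiable (fun x : R => g (x *: u + c)) x.
  by apply: (@differentiable_comp _ _ _ _ (fun x : R => x *: u + c) g).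
split; first exact/derivable1_diffP.
rewrite deriveE // (@diff_comp _ _ _ _ (fun x : R => x *: u + c) g) //=.
by rewrite el scale1r.
Qed.

(** The second difference is symmetric in [u] and [v], hence so is its limit. *)
Lemma second_increment f u v p (h : R) : 0 < h ->
  (forall x y : R, 0 <= x <= h -> 0 <= y <= h ->
    differentiable f (x *: u + (y *: v + p)) /\
    differentiable (fun q => 'd f q u) (x *: u + (y *: v + p))) ->
  exists x y : R, [/\ 0 <= x <= h, 0 <= y <= h &
    f (h *: u + (h *: v + p)) - f (h *: u + p) - f (h *: v + p) + f p =
    'd (fun q => 'd f q u) (x *: u + (y *: v + p)) v * h * h].
Proof.
move=> h0 df.
have hh : 0 <= h <= h by rewrite lexx (ltW h0).
have h00 : (0 : R) <= 0 <= h by rewrite lexx (ltW h0).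
(* The mean value theorem is applied in the direction [u] to this increment in [v], then in the
   direction [v] to the derivative it produces. *)
pose phi (x : R) := f (x *: u + (h *: v + p)) - f (x *: u + (0 *: v + p)).
pose dphi (x : R) := 'd f (x *: u + (h *: v + p)) u - 'd f (x *: u + (0 *: v + p)) u.
have dphiP x : 0 <= x <= h -> is_derive x 1 phi (dphi x).
  move=> xh; apply: is_deriveB; apply: is_derive_line.
    by have [] := df x h xh hh.
  by have [] := df x 0 xh h00.
have [x] : exists2 x, x \in `[0, h]%R & phi h - phi 0 = dphi x * (h - 0).
  apply: MVT_segment; first exact: ltW.
    by move=> x; rewrite in_itv/= => /andP[/ltW x0 /ltW xh]; apply: dphiP; rewrite x0.
  apply: derivable_within_continuous => x; rewrite in_itv/= => xh.
  by have [] := dphiP x xh.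
rewrite in_itv/= => xh ephi.
pose psi (y : R) := 'd f (y *: v + (x *: u + p)) u.
pose dpsi (y : R) := 'd (fun q => 'd f q u) (y *: v + (x *: u + p)) v.
have dpsiP y : 0 <= y <= h -> is_derive y 1 psi (dpsi y).
  move=> yh; apply: (@is_derive_line (fun q => 'd f q u)).
  by rewrite addrCA; have [] := df x y xh yh.
have [y] : exists2 y, y \in `[0, h]%R & psi h - psi 0 = dpsi y * (h - 0).
  apply: MVT_segment; first exact: ltW.
    by move=> y; rewrite in_itv/= => /andP[/ltW y0 /ltW yh]; apply: dpsiP; rewrite y0.
  apply: derivable_within_continuous => y; rewrite in_itv/= => yh.
  by have [] := dpsiP y yh.
rewrite in_itv/= => yh epsi.
exists x, y; split => //.
transitivity (phi h - phi 0).
  by rewrite /phi !scale0r !add0r opprB -!addrA; congr (_ + (_ + _)); rewrite addrC.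
rewrite ephi (_ : dphi x = psi h - psi 0); last first.
  by rewrite /dphi /psi !scale0r !add0r addrCA.
by rewrite epsi /dpsi subr0 addrCA.
Qed.

Lemma schwarz_scalar (A : set V) f p u v : smooth_on A f -> A p ->
  'd (fun q => 'd f q u) p v = 'd (fun q => 'd f q v) p u.
Proof.
move=> sf Ap.
pose fuv q := 'd (fun q => 'd f q u) q v.
pose fvu q := 'd (fun q => 'd f q v) q u.
have sfu := smooth_on_diff u sf; have sfv := smooth_on_diff v sf.
have cuv := smooth_on_continuous (smooth_on_diff v sfu) Ap.
have cvu := smooth_on_continuous (smooth_on_diff u sfv) Ap.
apply/eqP; rewrite -subr_eq0 -normr_le0; apply/ler_addgt0Pl => e e0; rewrite addr0.
have e2 : 0 < e / 2 by rewrite divr_gt0.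
have Qp : \forall q \near p, [/\ differentiable f q,
    differentiable (fun q => 'd f q u) q, differentiable (fun q => 'd f q v) q,
    `|fuv p - fuv q| <= e / 2 & `|fvu p - fvu q| <= e / 2].
  near=> q; split; near: q.
  - exact: smooth_on_near sf Ap.
  - exact: smooth_on_near sfu Ap.
  - exact: smooth_on_near sfv Ap.
  - by move/cvgrPdist_le : cuv; apply.
  - by move/cvgrPdist_le : cvu; apply.
(* [m] parametrises the parallelograms with vertex [p]; its continuity turns the neighbourhood of
   [p] just found into a square of parameters. *)
pose m (xy : R * R) : V := xy.1 *: u + (xy.2 *: v + p).
have cm : {for (0, 0), continuous m}.
  apply: continuousD.
    by apply: cvgZr_tmp; exact: cvg_fst.
  apply: continuousD; last exact: cst_continuous.
  by apply: cvgZr_tmp; exact: cvg_snd.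
have : nbhs ((0, 0) : R * R) (m @^-1` [set q | [/\ differentiable f q,
    differentiable (fun q => 'd f q u) q, differentiable (fun q => 'd f q v) q,
    `|fuv p - fuv q| <= e / 2 & `|fvu p - fvu q| <= e / 2]]).
  by apply: cm; rewrite /m /= !scale0r !add0r.
move=> /nbhs_ballP[d /= d0 dm].
have h0 : 0 < d / 2 by rewrite divr_gt0.
have Q (x y : R) : 0 <= x <= d / 2 -> 0 <= y <= d / 2 ->
    ball ((0, 0) : R * R) d (x, y).
  have lt (z : R) : 0 <= z <= d / 2 -> `|0 - z| < d.
    move=> /andP[z0 zd]; rewrite sub0r normrN ger0_norm // (le_lt_trans zd) //.
    by rewrite ltr_pdivrMr// ltr_pMr// ltr1n.
  by move=> /lt ? /lt ?; split.
have [x [y [xh yh e1]]] := second_increment h0 (fun x y xh yh =>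
   let: And5 a b _ _ _ := dm _ (Q x y xh yh) in conj a b).
have [|y' [x' [yh' xh' e3]]] := @second_increment f v u p (d / 2) h0.
  by move=> y' x' yh' xh'; rewrite addrCA; have [] := dm _ (Q x' y' xh' yh').
(* Both mixed derivatives, taken at two points that need not coincide, equal the second increment
   divided by [(d / 2) ^ 2]. *)
have : fuv (x *: u + (y *: v + p)) = fvu (x' *: u + (y' *: v + p)).
  apply: (@mulIf _ (d / 2)); first by rewrite gt_eqF.
  apply: (@mulIf _ (d / 2)); first by rewrite gt_eqF.
  rewrite /fuv /fvu -e1 [X in 'd _ X]addrCA -e3 addrCA.
  by rewrite -!addrA; congr (_ + _); rewrite addrCA.
have [_ _ _ /= h1 _] := dm _ (Q x y xh yh).
have [_ _ _ /= _ h2] := dm _ (Q x' y' xh' yh').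
rewrite /m /= in h1 h2; move=> e4; rewrite -/(fuv p) -/(fvu p).
rewrite (_ : fuv p - fvu p = (fuv p - fuv (x *: u + (y *: v + p))) -
   (fvu p - fvu (x' *: u + (y' *: v + p)))); last first.
  by rewrite e4 opprB addrA subrK.
by rewrite (le_trans (ler_normB _ _))// (splitr e) lerD.
Unshelve. all: by end_near. Qed.

Lemma differentiable_row_coord n (f : V -> 'rV[R]_n) p j :
  differentiable f p -> differentiable (fun q => f q 0 j) p.
Proof.
move=> df; apply: (@differentiable_comp _ _ _ _ f (fun M : 'rV[R]_n => M 0 j)) => //.
exact: differentiable_coord.
Qed.

Lemma diff_coord n (f : V -> 'rV[R]_n) p v j :
  differentiable f p -> 'd (fun q => f q 0 j) p v = 'd f p v 0 j.
Proof.
move=> df; rewrite -!deriveE//; last exact: differentiable_row_coord.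
by rewrite derive_mx ?mxE//; exact: diff_derivable.
Qed.

Lemma schwarz n (A : set V) (f : V -> 'rV[R]_n) p u v : smooth_on A f -> A p ->
  'd (fun q => 'd f q u) p v = 'd (fun q => 'd f q v) p u.
Proof.
move=> sf Ap; apply/rowP => j.
have dd w : differentiable (fun q => 'd f q w) p.
  exact: smooth_on_differentiable (smooth_on_diff w sf) Ap.
have e w w' : 'd (fun q => 'd (fun q => f q 0 j) q w) p w' =
    'd (fun q => 'd f q w) p w' 0 j.
  rewrite -(diff_coord w' j (dd w)).
  have [|_ ->//] := @near_eq_diff _ _ _ (fun q => 'd f q w 0 j)
     (fun q => 'd (fun q => f q 0 j) q w) p _ (differentiable_row_coord j (dd w)).
  by apply: filterS (smooth_on_near sf Ap) => q dfq; rewrite diff_coord.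
by rewrite -!e; apply: (schwarz_scalar _ _ (smooth_on_coord 0 j sf) Ap).
Qed.

End Schwarz.

(** * Partial derivatives and slices of maps of two variables *)

Section PartialDerivatives.
Variables (R : realType) (W : normedModType R).
Implicit Types (g : R -> R -> W) (t s : R).

(** The two difference quotients are the same function, so no differentiability of [g] enters. *)
Lemma derive1_fst g t s :
  derive1 (g ^~ s) t = 'D_(1, 0) (fun ts : R * R => g ts.1 ts.2) (t, s).
Proof.
rewrite derive1E /derive; set d := (fun _ : R => _); set d' := (fun _ : R => _).
suff -> : d = d' by [].
by apply/funext => h; rewrite /d /d' /= scaler0 add0r.
Qed.

Lemma derive1_snd g t s :
  derive1 (g t) s = 'D_(0, 1) (fun ts : R * R => g ts.1 ts.2) (t, s).
Proof.
rewrite derive1E /derive; set d := (fun _ : R => _); set d' := (fun _ : R => _).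
suff -> : d = d' by [].
by apply/funext => h; rewrite /d /d' /= scaler0 add0r.
Qed.

Lemma derivable_snd g t s : differentiable (fun ts : R * R => g ts.1 ts.2) (t, s) ->
  derivable (g t) s 1.
Proof.
move=> dg; have := @diff_derivable _ _ _ _ _ ((0, 1) : R * R) dg.
rewrite /derivable; set d := (fun _ : R => _); set d' := (fun _ : R => _).
suff -> : d = d' by [].
by apply/funext => h; rewrite /d /d' /= scaler0 add0r.
Qed.

End PartialDerivatives.

Section Slices.
Variables (R : realType) (V1 V2 W : normedModType R).
Implicit Types (f : V1 * V2 -> W).

(** A slice is the composite with the affine embedding [p |-> (p, 0) + (0, q)]. *)
Lemma smooth_on_slicel (A : set V1) (B : set (V1 * V2)) f q :
  (forall p, A p -> B (p, q)) -> smooth_on B f -> smooth_on A (fun p => f (p, q)).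
Proof.
move=> AB sf.
have lin : linear (fun p : V1 => (p, 0) : V1 * V2).
  by move=> a u v; rewrite /= -[RHS]/(_, _) /= scaler0 addr0.
pose lM := GRing.isLinear.Build _ _ _ _ _ lin.
pose l : {linear V1 -> (V1 * V2)%type} :=
  HB.pack (fun p : V1 => (p, 0) : V1 * V2) lM.
have cl : continuous l.
  move=> p; apply: differentiable_continuous.
  exact: (@differentiable_pair _ _ _ _ id (cst 0)).
have e p : l p + (0, q) = (p, q) by rewrite -[LHS]/(_, _) /= addr0 add0r.
apply: smooth_on_subset (eq_smooth_on _ (smooth_on_affr (0, q) cl sf)).
  by move=> p Ap; rewrite /preimage /= e; exact: AB.
by move=> p; rewrite e.
Qed.

Lemma smooth_on_slicer (A : set V2) (B : set (V1 * V2)) f p :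
  (forall q, A q -> B (p, q)) -> smooth_on B f -> smooth_on A (fun q => f (p, q)).
Proof.
move=> AB sf.
have lin : linear (fun q : V2 => (0, q) : V1 * V2).
  by move=> a u v; rewrite /= -[RHS]/(_, _) /= scaler0 addr0.
pose lM := GRing.isLinear.Build _ _ _ _ _ lin.
pose l : {linear V2 -> (V1 * V2)%type} :=
  HB.pack (fun q : V2 => (0, q) : V1 * V2) lM.
have cl : continuous l.
  move=> q; apply: differentiable_continuous.
  exact: (@differentiable_pair _ _ _ _ (cst 0) id).
have e q : l q + (p, 0) = (p, q) by rewrite -[LHS]/(_, _) /= addr0 add0r.
apply: smooth_on_subset (eq_smooth_on _ (smooth_on_affr (p, 0) cl sf)).
  by move=> q Aq; rewrite /preimage /= e; exact: AB.
by move=> q; rewrite e.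
Qed.

Lemma diff_slicer f p q v : differentiable f (p, q) ->
  'd (fun q => f (p, q)) q v = 'd f (p, q) (0, v).
Proof.
move=> df; have dp : differentiable (fun q => (p, q)) q.
  exact: (@differentiable_pair _ _ _ _ (cst p) id).
have [_ eid] := is_diff_id q.
rewrite (@diff_comp _ _ _ _ (fun q => (p, q)) f) //=.
by rewrite (@diff_pair _ _ _ _ (cst p) id)// diff_cst /= eid.
Qed.

End Slices.

(** * Integration over [[a, b]] and differentiation under the integral sign *)

Section Integrals.
Variables (R : realType) (a b : R).
Local Notation mu := (@lebesgue_measure R).

Lemma smooth_on_within_continuous (f : R -> R) :
  smooth_on `[a, b] f -> {within `[a, b], continuous f}.
Proof.
move=> sf; apply: continuous_in_subspaceT => t /set_mem; exact: smooth_on_continuous.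
Qed.

Lemma smooth_on_integrable (f : R -> R) :
  smooth_on `[a, b] f -> mu.-integrable `[a, b] (EFin \o f).
Proof.
move=> /smooth_on_within_continuous; apply: continuous_compact_integrable.
exact: segment_compact.
Qed.

Lemma smooth_on_FTC2 (F : R -> R) : a < b -> smooth_on `[a, b] F ->
  \int[mu]_(t in `[a, b]) derive1 F t = F b - F a.
Proof.
move=> ab sF.
have dF t : `[a, b]%classic t -> derivable F t 1.
  by move=> /(smooth_on_differentiable sF) /derivable1_diffP.
have cF t : `[a, b]%classic t -> {for t, continuous F}.
  by move=> tab; exact: smooth_on_continuous tab.
have sub t : t \in `]a, b[%R -> `[a, b]%classic t.
  by rewrite /= !in_itv/= => /andP[/ltW-> /ltW->].
have aab : `[a, b]%classic a by rewrite /= in_itv/= lexx ltW.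
have bab : `[a, b]%classic b by rewrite /= in_itv/= lexx ltW.
rewrite /Rintegral (@continuous_FTC2 _ _ F)//.
- apply: continuous_in_subspaceT => t /set_mem tab.
  have e q : differentiable F q -> derive1 F q = 'd F q 1 by exact: derive1E'.
  rewrite /continuous_at e; last exact: smooth_on_differentiable tab.
  apply: cvg_trans (smooth_on_continuous (smooth_on_diff (1 : R) sF) tab).
  apply: near_eq_cvg.
  by apply: filterS (smooth_on_near sF tab) => q dq; apply: esym; exact: e.
- split; first by move=> t /sub; exact: dF.
    exact/cvg_at_right_filter/cF.
  exact/cvg_at_left_filter/cF.
Qed.

(** Smoothness near the segment [s = 0] suffices: compactness supplies both a uniform range of [s]
    and a constant dominating the [s]-derivative. *)
Lemma is_derive_Rintegral (f : R -> R -> R) :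
  smooth_on (`[a, b] `*` [set 0]) (fun ts => f ts.1 ts.2) ->
  is_derive (0 : R) (1 : R) (fun s => \int[mu]_(t in `[a, b]) f t s)
    (\int[mu]_(t in `[a, b]) derive1 (f t) 0).
Proof.
set g := (X in smooth_on _ X) => sg.
have [U [oU AU Cg]] := sg.
have sgU : smooth_on U g by exists U; split.
pose dg (ts : R * R) := 'd g ts (0, 1).
have sdg : smooth_on U dg by exact: smooth_on_diff.
(* Tube lemma: the open set [U] contains the compact segment, hence a strip of uniform width around
   it. *)
have [e /= e0 eU] : exists2 e : R, 0 < e &
    forall s, `|s| < e -> forall t, `[a, b]%classic t -> U (t, s).
  have : \forall s \near (0 : R), `[a, b] `<=` [set t | U (t, s)].
    have /compact_near_coveringP := @segment_compact R a b.
    move=> /(_ _ (nbhs (0 : R)) (fun s t => U (t, s)) _); apply=> t tab.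
    have : nbhs ((t, 0) : R * R) U by apply: open_nbhs_nbhs; split=> //; exact: AU.
    by apply: filterS => -[].
  move=> /nbhs_ballP[e /= e0 eU]; exists e => // s se t; apply: eU.
  by rewrite /ball /= sub0r normrN.
have e20 : 0 < e / 2 by rewrite divr_gt0.
have Ue t s : `[a, b]%classic t -> `[- (e / 2), e / 2]%classic s -> U (t, s).
  move=> tab; rewrite /= in_itv/= -ler_norml => se; apply: eU => //.
  by rewrite (le_lt_trans se)// ltr_pdivrMr// ltr_pMr// ltr1n.
(* Halving [e] leaves a closed, hence compact, rectangle inside [U], on which [dg] is bounded. *)
have [M [M0 dgM]] : exists M : R, 0 <= M /\ forall t s, `[a, b]%classic t ->
    `[- (e / 2), e / 2]%classic s -> `|dg (t, s)| <= M.
  have cK := compact_setX (@segment_compact R a b)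
    (@segment_compact R (- (e / 2)) (e / 2)).
  have cdg : {within `[a, b] `*` `[- (e / 2), e / 2], continuous dg}.
    apply: continuous_in_subspaceT => -[t s] /set_mem[/= tab se].
    by apply: smooth_on_continuous sdg _; exact: Ue.
  have /compact_bounded[M [_ mrt]] := continuous_compact cdg cK.
  (* Every real strictly above [M] is a bound; this one is also nonnegative. *)
  exists (Num.max 0 M + 1); split.
    by rewrite addr_ge0// le_max lexx.
  move=> t s tab se; apply: (mrt (Num.max 0 M + 1)).
    by rewrite (@le_lt_trans _ _ (Num.max 0 M))// ?le_max ?lexx ?orbT// ltrDl.
  by exists (t, s).
have dfE t s : U (t, s) -> derive1 (f t) s = dg (t, s).
  by move=> Uts; rewrite derive1_snd deriveE//; exact: smooth_on_differentiable Uts.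
have sub (s : R) : `]- (e / 2), (e / 2)[%classic s -> `[- (e / 2), e / 2]%classic s.
  by rewrite /= !in_itv/= => /andP[/ltW-> /ltW->].
pose h s t := f t s.
have H0 : `]- (e / 2), (e / 2)[%classic (0 : R).
  by rewrite /= in_itv/= oppr_lt0 e20.
have H1 s : `]- (e / 2), (e / 2)[%classic s ->
    mu.-integrable `[a, b] (EFin \o h s).
  move=> /sub se; apply: smooth_on_integrable.
  by apply: smooth_on_slicel sgU => t tab; exact: Ue.
have H2 s t : `]- (e / 2), (e / 2)[%classic s -> `[a, b]%classic t ->
    derivable (h ^~ t) s 1.
  move=> /sub se tab; apply: derivable_snd.
  by apply: smooth_on_differentiable sgU _; exact: Ue.
have H3 : mu.-integrable `[a, b] (EFin \o cst M).
  by apply: smooth_on_integrable; exact: (@smooth_on_cst _ _ R).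
have H4 s t : `]- (e / 2), (e / 2)[%classic s -> `[a, b]%classic t ->
    `|partial1of2 h s t| <= M.
  by move=> /sub se tab; rewrite /partial1of2 dfE; [exact: dgM|exact: Ue].
split.
  exact: (derivable_under_integral _ H0 H1 H2 _ H3 H4).
by rewrite -derive1E (differentiation_under_integral _ H0 H1 H2 _ H3 H4).
Qed.

End Integrals.

(** * Sum, product and chain rules in [is_diff] form *)

Section DiffRules.
Variables (R : realType) (V : normedModType R).
Implicit Types (p v : V).

Lemma eq_is_diff (W : normedModType R) (f g : V -> W) df dg p :
  f =1 g -> df =1 dg -> is_diff p f df -> is_diff p g dg.
Proof. by move=> /funext-> /funext->. Qed.

Lemma is_diff_rV n (f : V -> 'rV[R]_n) (df : V -> 'rV[R]_n) p :
  (forall j, is_diff p (fun q => f q 0 j) (fun v => df v 0 j)) -> is_diff p f df.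
Proof.
move=> dfj.
have Df : differentiable f p.
  rewrite (_ : f = \sum_(j < n) (fun q => f q 0 j *: delta_mx 0 j)).
    by apply: differentiable_sum => j; apply: differentiableZl; case: (dfj j).
  by apply/funext => q; rewrite fct_sumE -row_sum_delta.
split=> //; apply/funext => v; apply/rowP => j.
by rewrite -diff_coord//; case: (dfj j) => _ ->.
Qed.

Lemma is_diff_coord n (f : V -> 'rV[R]_n) df p j :
  is_diff p f df -> is_diff p (fun q => f q 0 j) (fun v => df v 0 j).
Proof.
move=> [Df <-]; split; first exact: differentiable_row_coord.
by apply/funext => v; rewrite diff_coord.
Qed.

Lemma is_diff_mul (f g df dg : V -> R) p : is_diff p f df -> is_diff p g dg ->
  is_diff p (fun q => f q * g q) (fun v => f p * dg v + df v * g p).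
Proof.
move=> hf hg; have [D e] := is_diffM hf hg; split => //.
by apply/funext => v; rewrite [LHS](congr1 (fun h => h v) e) /= [df v * _]mulrC.
Qed.

Lemma is_diff_scale n (k dk : V -> R) (f df : V -> 'rV[R]_n) p :
  is_diff p k dk -> is_diff p f df ->
  is_diff p (fun q => k q *: f q) (fun v => k p *: df v + dk v *: f p).
Proof.
move=> hk hf; apply: is_diff_rV => j.
by apply: eq_is_diff (is_diff_mul hk (is_diff_coord j hf)) => q; rewrite !mxE.
Qed.

Lemma is_diff_bigsum (W : normedModType R) n (P : pred 'I_n)
    (f df : 'I_n -> V -> W) p :
  (forall i, is_diff p (f i) (df i)) ->
  is_diff p (fun q => \sum_(i < n | P i) f i q) (fun v => \sum_(i < n | P i) df i v).
Proof.
move=> hf; elim: (index_enum _) => [|i s ih].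
  by apply: eq_is_diff (is_diff_cst (0 : W) p) => q; rewrite big_nil.
have [Pi|Pi] := boolP (P i); last first.
  by apply: eq_is_diff ih => q; rewrite big_cons (negbTE Pi).
by apply: eq_is_diff (is_diffD (hf i) ih) => q; rewrite big_cons Pi.
Qed.

End DiffRules.

(** The base point [g q] and the direction [Y q] both move and contribute one term each. Expanding
    [Y q] in the standard basis leaves differentials of [f] in fixed directions, which are
    smooth. *)
Lemma is_diff_apply (R : realType) (V : normedModType R) m n (A : set 'rV[R]_n)
    (f : 'rV[R]_n -> 'rV[R]_m) (g dg Y dY : V -> 'rV[R]_n) p :
  smooth_on A f -> A (g p) -> is_diff p g dg -> is_diff p Y dY ->
  is_diff p (fun q => 'd f (g q) (Y q))
    (fun v => 'd (fun q => 'd f q (Y p)) (g p) (dg v) + 'd f (g p) (dY v)).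
Proof.
move=> sf Ap hg hY.
have sfk k : is_diff (g p) (fun q => 'd f q (delta_mx 0 k))
    ('d (fun q => 'd f q (delta_mx 0 k)) (g p)).
  exact/differentiableP/(smooth_on_differentiable (smooth_on_diff _ sf) Ap).
have expand q u : 'd f q u = \sum_(k < n) u 0 k *: 'd f q (delta_mx 0 k).
  rewrite {1}(row_sum_delta u) linear_sum /=.
  by apply: eq_bigr => k _; rewrite linearZ.
apply: eq_is_diff (is_diff_bigsum xpredT (fun k =>
    is_diff_scale (is_diff_coord k hY) (is_diff_comp hg (sfk k)))).
  by move=> q; rewrite [RHS]expand.
move=> v; rewrite big_split /= -expand; congr (_ + _).
(* Reassembles the coordinates of the first term into one differential, with the direction frozen at
   [Y p]. *)
have [_ e] : is_diff (g p) (fun q => 'd f q (Y p)) (fun w =>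
    \sum_(k < n) Y p 0 k *: 'd (fun q => 'd f q (delta_mx 0 k)) (g p) w);
  last exact: (esym (congr1 (fun h => h _) e)).
apply: eq_is_diff (is_diff_bigsum xpredT (fun k =>
    is_diff_scale (is_diff_cst (Y p 0 k) (g p)) (sfk k))).
  by move=> q; rewrite [RHS]expand.
by move=> w; apply: eq_bigr => k _; rewrite scale0r addr0.
Qed.

(** * Left-invariant fields and their brackets *)

Section LeftInvariance.
Variables (R : realType) (n : nat) (G : lieGroup R n).
Local Notation T := 'rV[R]_n.
Implicit Types (p q u v w : T).

Lemma gmulgV p : gmul G p (ginv G p) = gone G.
Proof.
rewrite -[LHS](gmul1g G) -{1}(gmulVg G (ginv G p)) -(gmulA G).
by rewrite (gmulA G (ginv G p)) gmulVg gmul1g gmulVg.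
Qed.

Lemma gmulg1 p : gmul G p (gone G) = p.
Proof. by rewrite -(gmulVg G p) gmulA gmulgV gmul1g. Qed.

Lemma smooth_on_lmul p : smooth_on setT (gmul G p).
Proof.
by apply: (smooth_on_slicer (f := fun pq => gmul G pq.1 pq.2)) (gmul_smooth G).
Qed.

Lemma differentiable_lmul p q : differentiable (gmul G p) q.
Proof. exact: (smooth_on_differentiable (smooth_on_lmul p)). Qed.

(** The field at [p] is the differential of the group law at [(p, gone G)] in the fixed direction
    [(0, v)]. *)
Lemma smooth_on_lie_field v : smooth_on setT (lie_field G v).
Proof.
have sd := smooth_on_diff ((0, v) : T * T) (gmul_smooth G).
apply: eq_smooth_on (smooth_on_slicel (q := gone G) (A := setT) _ sd) => // p.
rewrite /lie_field -(diff_slicer (f := fun pq => gmul G pq.1 pq.2)) //.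
exact: smooth_on_differentiable (gmul_smooth G) _.
Qed.

Lemma differentiable_lie_field v p : differentiable (lie_field G v) p.
Proof. exact: (smooth_on_differentiable (smooth_on_lie_field v)). Qed.

Lemma lie_fieldD v w p : lie_field G (v + w) p = lie_field G v p + lie_field G w p.
Proof. exact: linearD. Qed.

Lemma lie_fieldB v w p : lie_field G (v - w) p = lie_field G v p - lie_field G w p.
Proof. exact: linearB. Qed.

Lemma lie_fieldZ (c : R) v p : lie_field G (c *: v) p = c *: lie_field G v p.
Proof. exact: linearZ. Qed.

Lemma lie_field_one v : lie_field G v (gone G) = v.
Proof.
rewrite /lie_field (_ : gmul G (gone G) = id).
  by have [_ ->] := is_diff_id (gone G).
by apply/funext => p; rewrite gmul1g.
Qed.

(** Left invariance: by associativity translation by [gmul G p q] is a composite of two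
    translations, and the chain rule at the identity applies. *)
Lemma lie_field_lmul v p q :
  lie_field G v (gmul G p q) = 'd (gmul G p) q (lie_field G v q).
Proof.
have dq : is_diff (gone G) (gmul G q) (fun w => lie_field G w q).
  by split; [exact: differentiable_lmul|].
have dp : is_diff (gmul G q (gone G)) (gmul G p) ('d (gmul G p) q).
  by rewrite gmulg1; split; [exact: differentiable_lmul|].
have [_ e] : is_diff (gone G) (gmul G (gmul G p q))
    (fun w => 'd (gmul G p) q (lie_field G w q)).
  by apply: eq_is_diff (is_diff_comp dq dp) => // r; rewrite /= gmulA.
exact: (congr1 (fun h => h v) e).
Qed.

Lemma lmulV_lie_field v p : 'd (gmul G (ginv G p)) p (lie_field G v p) = v.
Proof. by rewrite -lie_field_lmul gmulVg lie_field_one. Qed.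

(** Obtained by differentiating [lie_field_lmul] at the identity; only the first
    summand involves the second derivative of the left translation, and it
    cancels in brackets. *)
Lemma diff_lie_field u v p : 'd (lie_field G v) p (lie_field G u p) =
  'd (fun q => 'd (gmul G p) q v) (gone G) u +
  'd (gmul G p) (gone G) ('d (lie_field G v) (gone G) u).
Proof.
have [_ e'] := is_diff_apply (smooth_on_lmul p) I (is_diff_id (gone G))
  (differentiableP (differentiable_lie_field v (gone G))).
have dp : is_diff (gone G) (gmul G p) (fun w => lie_field G w p).
  by split; [exact: differentiable_lmul|].
have dv : is_diff (gmul G p (gone G)) (lie_field G v) ('d (lie_field G v) p).
  by rewrite gmulg1; split; [exact: differentiable_lie_field|].
have [_ e] : is_diff (gone G) (fun q => 'd (gmul G p) q (lie_field G v q))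
    (fun w => 'd (lie_field G v) p (lie_field G w p)).
  by apply: eq_is_diff (is_diff_comp dp dv) => // r; rewrite /= lie_field_lmul.
transitivity ('d (fun q => 'd (gmul G p) q (lie_field G v q)) (gone G) u).
  exact: (esym (congr1 (fun h => h u) e)).
rewrite (lie_field_one v) in e'.
exact: (congr1 (fun h => h u) e').
Qed.

Lemma lie_bracketE u v : lie_bracket G u v =
  'd (lie_field G v) (gone G) u - 'd (lie_field G u) (gone G) v.
Proof. by rewrite /lie_bracket /vf_bracket (lie_field_one u) (lie_field_one v). Qed.

(** Once Schwarz removes the second derivatives of the translation, only the translate of the
    bracket at the identity remains. *)
Lemma vf_bracket_lie_field u v p :
  vf_bracket (lie_field G u) (lie_field G v) p = lie_field G (lie_bracket G u v) p.
Proof.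
have cancel (A A' B C : T) : A = A' -> A + B - (A' + C) = B - C.
  by move=> ->; rewrite opprD addrACA subrr add0r.
apply: (eq_trans (congr2 (fun x y => x - y)
  (diff_lie_field u v p) (diff_lie_field v u p))).
apply: (eq_trans (cancel _ _ _ _ (schwarz v u (smooth_on_lmul p) I))).
by rewrite lie_bracketE lie_fieldB.
Qed.

Lemma diff_lie_fieldP (c : R) v w p u : 'd (lie_field G (c *: v + w)) p u =
  c *: 'd (lie_field G v) p u + 'd (lie_field G w) p u.
Proof.
have [_ e] : is_diff p (lie_field G (c *: v + w))
    (fun u => c *: 'd (lie_field G v) p u + 'd (lie_field G w) p u).
  apply: eq_is_diff (is_diffD
    (is_diffZ c (differentiableP (differentiable_lie_field v p)))
    (differentiableP (differentiable_lie_field w p))) => // q.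
  by rewrite lie_fieldD lie_fieldZ.
exact: (congr1 (fun h => h u) e).
Qed.

Lemma lie_bracketC u v : lie_bracket G u v = - lie_bracket G v u.
Proof. by rewrite [RHS]opprB. Qed.

Lemma lie_bracket_linear u : linear (lie_bracket G u).
Proof.
move=> c v w; rewrite !lie_bracketE.
have gen (A B C D : T) : c *: A + B - (c *: C + D) = c *: (A - C) + (B - D).
  by rewrite scalerBr opprD addrACA.
apply: (eq_trans (congr2 (fun x y => x - y)
  (diff_lie_fieldP c v w (gone G) u) (linearP _ c v w))).
exact: gen.
Qed.

Lemma lie_bracket_suml u I (s : seq I) (P : pred I) (c : I -> R) (v : I -> T) :
  lie_bracket G u (\sum_(i <- s | P i) c i *: v i) =
  \sum_(i <- s | P i) c i *: lie_bracket G u (v i).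
Proof.
have b0 : lie_bracket G u 0 = 0.
  by have := lie_bracket_linear u (-1) 0 0; rewrite !scaleN1r !addNr.
elim: s => [|i s ih]; first by rewrite !big_nil.
by rewrite !big_cons; case: ifP => // _; rewrite lie_bracket_linear ih.
Qed.

(** Both arguments are expanded in the bases that generate the span; linearity is at hand in the
    second argument, so antisymmetry is used to reach the first and to come back. *)
Lemma mem_bracket_space (U W : {vspace T}) u w :
  u \in U -> w \in W -> lie_bracket G u w \in bracket_space G U W.
Proof.
move=> uU wW; rewrite (coord_vbasis wW) lie_bracket_suml.
apply: memv_suml => j _; apply: memvZ; rewrite lie_bracketC memvN.
rewrite (coord_vbasis uU) lie_bracket_suml.
apply: memv_suml => i _; apply: memvZ; rewrite lie_bracketC memvN.
apply: memv_span; apply/allpairsP; exists ((vbasis U)`_i, (vbasis W)`_j).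
by split; rewrite //= mem_nth// size_tuple.
Qed.

End LeftInvariance.

(** * Components with respect to the left-invariant frame *)

Section Frame.
Variables (R : realType) (n : nat) (G : carnotGroup R n) (E : n.-tuple 'rV[R]_n).
Hypothesis bE : basis_of fullv E.
Local Notation T := 'rV[R]_n.
Local Notation X := (frame G E).
Implicit Types (p u v w : T) (i j k : 'I_n).

Lemma smooth_on_frame i : smooth_on setT (X i).
Proof. exact: smooth_on_lie_field. Qed.

Lemma differentiable_frame i p : differentiable (X i) p.
Proof. exact: differentiable_lie_field. Qed.

Lemma nth_frame p i : [tuple X j p | j < n]`_i = X i p.
Proof. by rewrite -tnth_nth tnth_mktuple. Qed.

Lemma lie_field_sum (c : 'I_n -> R) p :
  lie_field G (\sum_i c i *: tnth E i) p = \sum_i c i *: X i p.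
Proof.
rewrite /lie_field linear_sum /=; apply: eq_bigr => i _; exact: linearZ.
Qed.

(** The differential of the translation by the inverse of [p] carries a relation at [p] back to one
    between the members of [E]. *)
Lemma frame_free p : free [tuple X j p | j < n].
Proof.
apply/freeP => c; under eq_bigr do rewrite nth_frame.
rewrite -lie_field_sum => /(congr1 ('d (gmul G (ginv G p)) p)).
rewrite lmulV_lie_field linear0; under eq_bigr do rewrite (tnth_nth 0).
exact/freeP/(basis_free bE).
Qed.

Lemma frame_basis p : basis_of fullv [tuple X j p | j < n].
Proof.
by rewrite basisEfree frame_free subvf size_tuple dimvf /dim /= mul1n.
Qed.

Lemma comp_sum p (c : 'I_n -> R) i : comp G E p (\sum_j c j *: X j p) i = c i.
Proof.
rewrite /comp; under eq_bigr do rewrite -nth_frame.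
exact: coord_sum_free (frame_free p).
Qed.

Lemma comp_expand p u : u = \sum_i comp G E p u i *: X i p.
Proof.
rewrite {1}(coord_basis (frame_basis p) (memvf u)).
by under eq_bigr do rewrite nth_frame.
Qed.

Lemma comp_ext p u v : (forall i, comp G E p u i = comp G E p v i) -> u = v.
Proof.
move=> h; rewrite (comp_expand p u) (comp_expand p v).
by apply: eq_bigr => i _; rewrite h.
Qed.

Lemma compD p u v i : comp G E p (u + v) i = comp G E p u i + comp G E p v i.
Proof. exact: linearD. Qed.

Lemma compB p u v i : comp G E p (u - v) i = comp G E p u i - comp G E p v i.
Proof. exact: linearB. Qed.

Lemma compZ p (c : R) u i : comp G E p (c *: u) i = c * comp G E p u i.
Proof. exact: linearZ. Qed.

Lemma comp0 p i : comp G E p 0 i = 0.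
Proof. exact: linear0. Qed.

Lemma comp_bigsum p I (s : seq I) (P : pred I) (F : I -> T) i :
  comp G E p (\sum_(j <- s | P j) F j) i = \sum_(j <- s | P j) comp G E p (F j) i.
Proof. exact: linear_sum. Qed.

Lemma comp_frame p i j : comp G E p (X j p) i = (i == j)%:R.
Proof.
rewrite -[X j p](_ : \sum_k (k == j)%:R *: X k p = _) ?comp_sum//.
rewrite (bigD1 j)//= eqxx scale1r big1 ?addr0// => k /negbTE ->.
by rewrite scale0r.
Qed.

Lemma comp_lie_field p v i : comp G E p (lie_field G v p) i = coord E i v.
Proof.
rewrite {1}(coord_basis bE (memvf v)); under eq_bigr do rewrite -tnth_nth.
by rewrite lie_field_sum comp_sum.
Qed.

Lemma metricC p u v : metric G E p u v = metric G E p v u.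
Proof. by apply: eq_bigr => i _; rewrite mulrC. Qed.

Lemma metric_frame p u i : metric G E p u (X i p) = comp G E p u i.
Proof.
rewrite /metric (bigD1 i)//= comp_frame eqxx mulr1 big1 ?addr0// => j ji.
by rewrite comp_frame (negbTE ji) mulr0.
Qed.

Lemma comp_sum_cond p (P : pred 'I_n) (c : 'I_n -> R) i :
  comp G E p (\sum_(j < n | P j) c j *: X j p) i = if P i then c i else 0.
Proof.
rewrite big_mkcond -(comp_sum p (fun j => if P j then c j else 0)).
congr (comp _ _ _ _ _); apply: eq_bigr => j _.
by case: ifP => // _; rewrite scale0r.
Qed.

Lemma comp_vfield p (P : 'I_n -> R) i :
  comp G E p (vfield G E P p) i = if (hdim G <= i)%N then P i else 0.
Proof. exact: comp_sum_cond. Qed.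

Lemma comp_hproj p u i :
  comp G E p (hproj G E p u) i = if (i < hdim G)%N then comp G E p u i else 0.
Proof. by rewrite comp_sum_cond metric_frame. Qed.

Lemma comp_Cact p (P : 'I_n -> R) u i : comp G E p (Cact G E P p u) i =
  \sum_j (\sum_(al < n | (hdim G <= al)%N) P al * struct_const G E al i j) *
    comp G E p u j.
Proof.
rewrite comp_sum mxE; apply: eq_bigr => j _; rewrite !mxE summxE; congr (_ * _).
by apply: eq_bigr => al _; rewrite !mxE.
Qed.

(** The bracket is again left-invariant, so its components are constant and can be read at the
    identity, where [struct_const] is defined. *)
Lemma vf_bracket_frame i j p :
  vf_bracket (X i) (X j) p = \sum_r struct_const G E r i j *: X r p.
Proof.
rewrite /struct_const [LHS]vf_bracket_lie_field.
rewrite [LHS](comp_expand p); apply: eq_bigr => r _; congr (_ *: _).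
rewrite metric_frame comp_lie_field -(comp_lie_field (gone G)).
by rewrite lie_field_one.
Qed.

Lemma struct_constC r i j : struct_const G E r i j = - struct_const G E r j i.
Proof.
rewrite /struct_const !metric_frame /vf_bracket !compB opprB.
by [].
Qed.

(** The components of the standard basis vectors are the entries of the inverse of this matrix; that
    is how components are seen to depend smoothly on the point. *)
Let frame_mx p := \matrix_(i < n, k < n) X i p 0 k.

Let frame_mxK p :
  frame_mx p *m \matrix_(k < n, i < n) comp G E p (delta_mx 0 k) i = 1%:M.
Proof.
apply/matrixP => i j; rewrite !mxE; transitivity (comp G E p (X i p) j).
  rewrite (row_sum_delta (X i p)) comp_bigsum; apply: eq_bigr => k _.
  by rewrite !mxE compZ.
by rewrite comp_frame eq_sym.
Qed.

Let comp_invmx p k i : comp G E p (delta_mx 0 k) i = invmx (frame_mx p) k i.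
Proof.
have [uM _] := mulmx1_unit (frame_mxK p).
have := congr1 (mulmx (invmx (frame_mx p))) (frame_mxK p).
by rewrite mulKmx// mulmx1 => /matrixP/(_ k i); rewrite mxE.
Qed.

Lemma comp_rowE p u i : comp G E p u i =
  \sum_k u 0 k * comp G E p (delta_mx 0 k) i.
Proof.
rewrite {1}(row_sum_delta u) comp_bigsum; apply: eq_bigr => k _.
by rewrite compZ.
Qed.

Lemma smooth_on_comp_delta k i :
  smooth_on setT (fun p => comp G E p (delta_mx 0 k) i).
Proof.
apply: (@eq_smooth_on _ _ _ _ (fun p => invmx (frame_mx p) k i)).
  by move=> p; rewrite comp_invmx.
apply: smooth_on_invmx => [p|i' j']; first by have [] := mulmx1_unit (frame_mxK p).
apply: (@eq_smooth_on _ _ _ _ (fun p => X i' p 0 j')); first by move=> p; rewrite mxE.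
exact/smooth_on_coord/smooth_on_frame.
Qed.

Lemma smooth_on_compf (V : normedModType R) (A : set V) (z u : V -> T) i :
  smooth_on A z -> smooth_on A u -> smooth_on A (fun s => comp G E (z s) (u s) i).
Proof.
move=> sz su; apply: (@eq_smooth_on _ _ _ _
  (fun s => \sum_k u s 0 k * comp G E (z s) (delta_mx 0 k) i)).
  by move=> s; rewrite -comp_rowE.
apply: smooth_on_sum => k _; apply: smooth_onM; first exact: smooth_on_coord.
by apply: (smooth_on_comp (B := setT)) (smooth_on_comp_delta k i).
Qed.

End Frame.

(** * Vanishing of the horizontal structure constants *)

Section HorizontalBrackets.
Variables (R : realType) (n : nat) (G : carnotGroup R n) (E : n.-tuple 'rV[R]_n).
Hypothesis hE : adapted_frame G E.

(** The block of [E] spanning layer [m] starts after the blocks of all lower layers, in particular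
    after the first [hdim G] positions. *)
Lemma coord_layer m (r : 'I_n) w : (1 < m <= step G)%N -> (r < hdim G)%N ->
  w \in layer G m -> coord E r w = 0.
Proof.
move=> /andP[m1 ms] rh; have [bE /(_ m)] := hE.
rewrite (ltnW m1) ms => /(_ isT) bm wm.
have hs : (hdim G <= \sum_(1 <= l < m) \dim (layer G l))%N.
  by rewrite big_ltn// leq_addr.
rewrite (coord_basis (X := in_tuple _) bm wm) linear_sum big1// => k _.
rewrite linearZ /=; have kd : (k < \dim (layer G m))%N.
  by apply: leq_trans (ltn_ord k) _; rewrite size_map size_iota.
rewrite (nth_map 0%N) ?size_iota// nth_iota//.
(* Past the end of [E] the default value [0] is read and contributes nothing, which avoids comparing
   the sum of the dimensions with [n]. *)
have [kn|nk] := ltnP (\sum_(1 <= l < m) \dim (layer G l) + k) n; last first.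
  by rewrite nth_default ?size_tuple// linear0 mulr0.
rewrite -[(_ + _)%N]/(val (Ordinal kn)) coord_free ?(basis_free bE)//.
rewrite -val_eqE /= gtn_eqF ?mulr0// (leq_trans rh)// (leq_trans hs)//.
by rewrite leq_addr.
Qed.

Lemma coord_lie_bracket (i r : 'I_n) v : (i < hdim G)%N -> (r < hdim G)%N ->
  coord E r (lie_bracket G (tnth E i) v) = 0.
Proof.
move=> ih rh; have [bE bl] := hE.
have Ei : tnth E i \in layer G 1.
  have := bl 1%N; rewrite step_gt0 => /(_ isT) b1.
  apply: (basis_mem b1); rewrite big_geq// (tnth_nth 0).
  by apply: map_f; rewrite mem_iota.
have : v \in (\sum_(l < step G) layer G l.+1)%VS by rewrite layer_full memvf.
move=> /memv_sumP[vs vsl ->].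
rewrite (_ : \sum_(l < _) _ = \sum_(l < step G) 1 *: vs l); last first.
  by apply: eq_bigr => l _; rewrite scale1r.
rewrite lie_bracket_suml linear_sum big1// => l _; rewrite scale1r.
have := mem_bracket_space G Ei (vsl l isT).
(* Layers are numbered from 1, so [l] stands for layer [l.+1]. Below the top its bracket lands in
   layer [l.+2]; at the top the bracket is zero by [layer_last]. *)
have [sl|ls] := ltnP l.+1 (step G).
  rewrite (@layer_bracket _ _ G l.+2) //; exact: coord_layer.
have -> : l.+1 = step G by apply/eqP; rewrite eqn_leq ls ltn_ord.
by rewrite layer_last memv0 => /eqP ->; rewrite linear0.
Qed.

Lemma struct_const_horizontal (r i j : 'I_n) : (r < hdim G)%N -> (i < hdim G)%N ->
  struct_const G E r i j = 0.
Proof.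
move=> rh ih; have [bE _] := hE.
rewrite /struct_const metric_frame// vf_bracket_lie_field comp_lie_field//.
exact: coord_lie_bracket.
Qed.

End HorizontalBrackets.

(** * The structure equation along a smooth map *)

Section StructureEquation.
Variables (R : realType) (n : nat) (G : carnotGroup R n) (E : n.-tuple 'rV[R]_n).
Hypothesis bE : basis_of fullv E.
Variables (V : normedModType R) (A : set V) (Th : V -> 'rV[R]_n).
Hypothesis sTh : smooth_on A Th.
Local Notation X := (frame G E).
Local Notation vel e := (fun q k => comp G E (Th q) ('d Th q e) k).

(** Product rule for the expansion of ['d Th q e] in the frame: the frame moves along [Th], which
    gives the double sum, and the components vary, which gives the last term. *)
Lemma second_diff_frame q e e' k : A q ->
  comp G E (Th q) ('d (fun q => 'd Th q e) q e') k =
  \sum_i \sum_j vel e q i * vel e' q j *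
      comp G E (Th q) ('d (X i) (Th q) (X j (Th q))) k +
    'd (fun q => vel e q k) q e'.
Proof.
move=> Aq.
have dTh : is_diff q Th ('d Th q).
  exact/differentiableP/(smooth_on_differentiable sTh Aq).
have dvel i : is_diff q (fun q => vel e q i) ('d (fun q => vel e q i) q).
  apply/differentiableP; apply: (smooth_on_differentiable _ Aq).
  exact: (smooth_on_compf G bE i sTh (smooth_on_diff e sTh)).
have dX i := is_diff_comp dTh (differentiableP (differentiable_frame G E i (Th q))).
have [_ eq] : is_diff q (fun q => 'd Th q e) (fun v => \sum_i
    (vel e q i *: 'd (X i) (Th q) ('d Th q v) +
     'd (fun q => vel e q i) q v *: X i (Th q))).
  apply: eq_is_diff (is_diff_bigsum xpredT
    (fun i => is_diff_scale (dvel i) (dX i))) => // r.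
  by rewrite [RHS](comp_expand G bE (Th r)).
apply: (eq_trans (congr1 (fun h => comp G E (Th q) (h e') k) eq)).
rewrite comp_bigsum.
under eq_bigr do rewrite compD !compZ.
rewrite big_split /=; congr (_ + _); last first.
  rewrite (bigD1 k)//= comp_frame// eqxx mulr1 big1 ?addr0// => i ik.
  by rewrite comp_frame// eq_sym (negbTE ik) mulr0.
apply: eq_bigr => i _.
rewrite {1}(comp_expand G bE (Th q) ('d Th q e')) linear_sum comp_bigsum mulr_sumr.
by apply: eq_bigr => j _; rewrite linearZ compZ mulrA.
Qed.

(** The Maurer-Cartan equation pulled back by [Th]: in the difference of the two mixed second
    derivatives, the derivatives of the frame fields pair up into brackets. *)
Lemma structure_equation q e e' k : A q ->
  'd (fun q => vel e q k) q e' = 'd (fun q => vel e' q k) q e +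
    \sum_i \sum_j vel e q i * vel e' q j * struct_const G E k i j.
Proof.
move=> Aq; have h := congr1 (fun w => comp G E (Th q) w k) (schwarz e e' sTh Aq).
have := eq_trans (esym (second_diff_frame e e' k Aq))
  (eq_trans h (second_diff_frame e' e k Aq)).
set D := fun i j => comp G E (Th q) ('d (X i) (Th q) (X j (Th q))) k.
have Cij i j : struct_const G E k i j = D j i - D i j.
  by rewrite -compB -[_ - _]/(vf_bracket _ _ _) vf_bracket_frame// comp_sum.
have gen (a b c d : R) : a + b = c + d -> b = d + (c - a).
  by move=> abcd; rewrite addrA [d + c]addrC -abcd [a + b]addrC addrK.
move=> /gen ->; congr (_ + _).
rewrite [X in X - _]exchange_big /= -sumrB; apply: eq_bigr => i _.
rewrite -sumrB; apply: eq_bigr => j _.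
by rewrite Cij mulrBr [vel e' q j * _]mulrC.
Qed.

End StructureEquation.

(** * The Levi-Civita connection in the frame *)

Section LeviCivita.
Variables (R : realType) (n : nat) (G : carnotGroup R n) (E : n.-tuple 'rV[R]_n).
Hypothesis hE : adapted_frame G E.
Variable nabla : ('rV[R]_n -> 'rV[R]_n) -> ('rV[R]_n -> 'rV[R]_n) ->
  ('rV[R]_n -> 'rV[R]_n).
Hypothesis hnabla : levi_civita G E nabla.
Local Notation T := 'rV[R]_n.
Local Notation X := (frame G E).
Let bE : basis_of fullv E. Proof. by case: hE. Qed.

(** Connection coefficients in the orthonormal frame instead of coordinates: skew in [j] and [k],
    and not symmetric in [i] and [j]. *)
Definition christoffel p (i j k : 'I_n) := comp G E p (nabla (X i) (X j) p) k.

(** Metric compatibility is applied to the inner product of two frame fields, which is constant. *)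
Lemma christoffel_metric p i j k : christoffel p i j k = - christoffel p i k j.
Proof.
have := nabla_metric hnabla (smooth_on_frame G E i) (smooth_on_frame G E j)
  (smooth_on_frame G E k) p.
have [_ ->] : is_diff p (fun q => metric G E q (X j q) (X k q)) (0 : T -> R).
  apply: eq_is_diff (is_diff_cst ((k == j)%:R : R) p) => // q.
  by rewrite metric_frame// comp_frame.
rewrite metric_frame// metricC metric_frame// => /esym/eqP.
by rewrite addr_eq0 => /eqP.
Qed.

Lemma christoffel_torsion p i j k :
  christoffel p i j k - christoffel p j i k = struct_const G E k i j.
Proof.
rewrite /christoffel -compB (nabla_torsion_free hnabla (smooth_on_frame G E i)
  (smooth_on_frame G E j)).
by rewrite vf_bracket_frame// comp_sum.
Qed.

(** For horizontal [i] and [j] the constant [C^i_jk] is zero, so skewness and torsion-freeness turn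
    [christoffel p j i k] into [- christoffel p k j i]. This is skew in [i] and [j], whereas
    [a i * a j] is symmetric: the sum equals its opposite. *)
Lemma christoffel_horizontal p (a : 'I_n -> R) k :
  (forall i : 'I_n, (hdim G <= i)%N -> a i = 0) ->
  \sum_i \sum_j a i * a j * christoffel p j i k = 0.
Proof.
move=> ah.
have e i j : a i * a j * christoffel p j i k = - (a i * a j * christoffel p k j i).
  have [ih|/ah ->] := ltnP i (hdim G); last by rewrite !mul0r oppr0.
  have [jh|/ah ->] := ltnP j (hdim G); last by rewrite mulr0 !mul0r oppr0.
  rewrite christoffel_metric mulrN; congr (- (_ * _)); apply/eqP.
  by rewrite -subr_eq0 christoffel_torsion (struct_const_horizontal hE).
have : \sum_i \sum_j a i * a j * christoffel p j i k =
    - \sum_i \sum_j a i * a j * christoffel p j i k.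
  rewrite [LHS]exchange_big /= -sumrN; apply: eq_bigr => i _.
  rewrite -sumrN; apply: eq_bigr => j _.
  by rewrite !e opprK (christoffel_metric p k i j) mulrN opprK [a j * _]mulrC.
by move=> /eqP; rewrite -addr_eq0 -mulr2n mulrn_eq0 => /eqP.
Qed.

Lemma nabla_suml (f : 'I_n -> T -> R) Z p : (forall i, smooth_on setT (f i)) ->
  smooth_on setT Z ->
  nabla (fun q => \sum_i f i q *: X i q) Z p = \sum_i f i p *: nabla (X i) Z p.
Proof.
move=> sf sZ.
have n0 : nabla (cst 0) Z p = 0.
  have := nabla_linl hnabla (@smooth_on_cst _ _ R setT 1)
    (@smooth_on_cst _ _ T setT 0) (@smooth_on_cst _ _ T setT 0) sZ p.
  rewrite (_ : (fun _ : T => _) = cst 0); last first.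
    by apply/funext => q; rewrite scaler0 addr0.
  by rewrite scale1r => /eqP; rewrite -subr_eq subrr => /eqP.
elim: (index_enum _) => [|i s ih].
  rewrite big_nil -[RHS]n0; congr (nabla _ _ _); apply/funext => q.
  by rewrite big_nil.
rewrite big_cons -ih -(nabla_linl hnabla)//; last 2 first.
- exact: smooth_on_frame.
- by apply: smooth_on_sum => j _; apply: smooth_onZ; [|exact: smooth_on_frame].
by congr (nabla _ _ _); apply/funext => q; rewrite big_cons.
Qed.

Lemma nabla_sumr (f : 'I_n -> T -> R) Z p : (forall i, smooth_on setT (f i)) ->
  smooth_on setT Z ->
  nabla Z (fun q => \sum_i f i q *: X i q) p =
  \sum_i ('d (f i) p (Z p) *: X i p + f i p *: nabla Z (X i) p).
Proof.
move=> sf sZ.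
have n0 : nabla Z (cst 0) p = 0.
  have := nabla_addr hnabla sZ (@smooth_on_cst _ _ T setT 0)
    (@smooth_on_cst _ _ T setT 0) p.
  rewrite (_ : (fun _ : T => _) = cst 0); last first.
    by apply/funext => q; rewrite addr0.
  by move=> /eqP; rewrite -subr_eq subrr => /eqP.
elim: (index_enum _) => [|i s ih].
  rewrite big_nil -[RHS]n0; congr (nabla _ _ _); apply/funext => q.
  by rewrite big_nil.
have sfX j : smooth_on setT (fun q => f j q *: X j q).
  by apply: smooth_onZ; [|exact: smooth_on_frame].
rewrite big_cons -ih -(nabla_leibniz hnabla)//; last exact: smooth_on_frame.
rewrite -(nabla_addr hnabla)//; last first.
  by apply: smooth_on_sum => j _; exact: sfX.
by congr (nabla _ _ _); apply/funext => q; rewrite big_cons.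
Qed.

(** A field that is constant in coordinates has variable components in the frame; the Leibniz rule
    produces their derivative, the first term. *)
Lemma nabla_cst u w p k : comp G E p (nabla (cst u) (cst w) p) k =
  'd (fun q => comp G E q w k) p u + \sum_i \sum_j comp G E p w i *
    comp G E p u j * christoffel p j i k.
Proof.
have cE v : cst v = (fun q => \sum_i comp G E q v i *: X i q) :> (T -> T).
  by apply/funext => q; exact: comp_expand.
have sid := @smooth_on_id _ T setT.
have sc v i : smooth_on setT (fun q => comp G E q v i).
  by apply: (smooth_on_compf G bE _ sid (smooth_on_cst _ v)).
rewrite (cE w) nabla_sumr//; last exact: smooth_on_cst.
rewrite comp_bigsum; under eq_bigr do rewrite compD !compZ.
rewrite big_split /=; congr (_ + _).
  rewrite (bigD1 k)//= comp_frame// eqxx mulr1 big1 ?addr0// => i ik.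
  by rewrite comp_frame// eq_sym (negbTE ik) mulr0.
apply: eq_bigr => i _; rewrite (cE u) nabla_suml//; last exact: smooth_on_frame.
rewrite comp_bigsum mulr_sumr; apply: eq_bigr => j _.
by rewrite compZ mulrA.
Qed.

Lemma is_diff_comp_frame (V : normedModType R) (z dz u du : V -> T) p k :
  is_diff p z dz -> is_diff p u du ->
  is_diff p (fun s => comp G E (z s) (u s) k)
    (fun v => 'd (fun q => comp G E q (u p) k) (z p) (dz v) +
              comp G E (z p) (du v) k).
Proof.
move=> hz hu; pose c l q := comp G E q (delta_mx 0 l) k.
have dc l : is_diff (z p) (c l) ('d (c l) (z p)).
  apply/differentiableP.
  exact: (smooth_on_differentiable (smooth_on_comp_delta G bE l k)).
apply: eq_is_diff (is_diff_bigsum xpredT (fun l =>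
    is_diff_mul (is_diff_coord l hu) (is_diff_comp hz (dc l)))).
  by move=> s; rewrite [RHS]comp_rowE.
move=> v; rewrite big_split /=; congr (_ + _); last by rewrite [RHS]comp_rowE.
have [_ e] : is_diff (z p) (fun q => comp G E q (u p) k)
    (fun w => \sum_(l < n) u p 0 l * 'd (c l) (z p) w);
  last exact: (esym (congr1 (fun h => h _) e)).
apply: eq_is_diff (is_diff_bigsum xpredT (fun l =>
    is_diff_mul (is_diff_cst (u p 0 l) (z p)) (dc l))).
  by move=> q; rewrite [RHS]comp_rowE.
by move=> w; apply: eq_bigr => l _; rewrite mul0r addr0.
Qed.

(** The derivative of a component of [W] along [x] consists of the component of [W'] and of a term
    due to the change of frame; the latter is exactly the first term of [nabla_cst]. *)
Lemma comp_cov_deriv (x W : R -> T) t k : differentiable x t -> differentiable W t ->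
  comp G E (x t) (cov_deriv nabla x W t) k =
  derive1 (fun s => comp G E (x s) (W s) k) t +
  \sum_i \sum_j comp G E (x t) (W t) i * comp G E (x t) (derive1 x t) j *
    christoffel (x t) j i k.
Proof.
move=> dx dW.
have [D e] := is_diff_comp_frame k (differentiableP dx) (differentiableP dW).
rewrite compD nabla_cst addrA; congr (_ + _).
apply: esym; apply: (eq_trans (derive1E' D)).
apply: (eq_trans (congr1 (fun h => h 1) e)).
by rewrite (derive1E' dx) (derive1E' dW) addrC.
Qed.

End LeviCivita.

(** The derivatives at an endpoint of [[a, b]] are determined by the values in
    [[a, b]], as one-sided derivatives. *)
Lemma derive1_eq_itv (R : realType) (W : normedModType R) (a b t : R)
    (f g : R -> W) :
  a < b -> t \in `[a, b]%R -> derivable f t 1 -> derivable g t 1 ->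
  (forall s, s \in `[a, b]%R -> f s = g s) -> derive1 f t = derive1 g t.
Proof.
move=> ab tab df dg fg.
have dq (h : R -> W) (F : set_system R) : derivable h t 1 -> F `=>` 0^' ->
    (fun e => e^-1 *: (h (e + t) - h t)) @ F --> derive1 h t.
  move=> dh F0; rewrite derive1E.
  have dh' : (fun e => e^-1 *: (h (e + t) - h t)) @ 0^' --> 'D_1 h t.
    by under eq_fun do rewrite -[X in h (X + t)]mulr1; exact: dh.
  exact: cvg_trans (cvg_app _ F0) dh'.
have uniq (F : set_system R) : ProperFilter F -> F `=>` 0^' ->
    (\forall e \near F, e + t \in `[a, b]%R) -> derive1 f t = derive1 g t.
  move=> PF F0 Fab; have /cvg_lim <- // := dq f F df F0.
  apply: cvg_lim => //; apply: cvg_trans (dq g F dg F0).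
  apply: near_eq_cvg; apply: filterS Fab => e etab.
  by rewrite !fg.
move: (tab); rewrite in_itv/= => /andP[at_ tb].
(* Limits from the right remain in the interval as long as [t < b]; at [b] the limit from the left
   is used, and [a < b] leaves room for it. *)
have [{}tb|bt] := ltP t b.
  apply: (uniq 0^'+).
    by move=> A [e /= e0 eA]; exists e => //= y ye y0; apply: eA => //; rewrite gt_eqF.
  near=> e; rewrite in_itv/=; apply/andP; split.
    by rewrite (le_trans at_)// lerDr ltW.
  rewrite -lerBrDr; near: e; apply: nbhs_right_le; by rewrite subr_gt0.
have {}at_ : a < t by exact: lt_le_trans bt.
apply: (uniq 0^'-).
  by move=> A [e /= e0 eA]; exists e => //= y ye y0; apply: eA => //; rewrite lt_eqF.
near=> e; rewrite in_itv/=; apply/andP; split.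
  rewrite -lerBlDr; near: e; apply: nbhs_left_ge; by rewrite subr_lt0.
by rewrite (le_trans _ tb)// gerDr ltW.
Unshelve. all: by end_near. Qed.

Lemma smooth_on_derive (R : realType) (V W : normedModType R) (A : set V)
  (f : V -> W) v : smooth_on A f -> smooth_on A (fun p => 'D_v f p).
Proof.
move=> [U [oU AU Cf]]; exists U; split=> // r.
have [df ddf] := Cf r.+1.
by apply: eq_Cr (ddf v) => // p Up; apply: esym; apply: deriveE; exact: df.
Qed.

Section CurriedDerivatives.
Variables (R : realType) (W : normedModType R).
Implicit Types (A : set (R * R)) (g : R -> R -> W).

Lemma smooth_on_derive1_fst A g : smooth_on A (fun ts => g ts.1 ts.2) ->
  smooth_on A (fun ts => derive1 (g ^~ ts.2) ts.1).
Proof.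
move=> /(smooth_on_derive ((1, 0) : R * R)).
by apply: eq_smooth_on => -[t s]; rewrite derive1_fst.
Qed.

Lemma smooth_on_derive1_snd A g : smooth_on A (fun ts => g ts.1 ts.2) ->
  smooth_on A (fun ts => derive1 (g ts.1) ts.2).
Proof.
move=> /(smooth_on_derive ((0, 1) : R * R)).
by apply: eq_smooth_on => -[t s]; rewrite derive1_snd.
Qed.

End CurriedDerivatives.

Lemma smooth_on_derive1 (R : realType) (W : normedModType R) (A : set R)
  (f : R -> W) : smooth_on A f -> smooth_on A (derive1 f).
Proof.
move=> /(smooth_on_derive (1 : R)).
by apply: eq_smooth_on => t; rewrite derive1E.
Qed.

(** * Mixed derivatives of the velocity components *)

Section FirstVariation.
Variables (R : realType) (n : nat) (G : carnotGroup R n) (E : n.-tuple 'rV[R]_n).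
Hypothesis hE : adapted_frame G E.
Local Notation T := 'rV[R]_n.
Let bE : basis_of fullv E. Proof. by case: hE. Qed.

Section Velocities.
Variables (A : set (R * R)) (theta : R -> R -> T).
Hypothesis stheta : smooth_on A (fun ts => theta ts.1 ts.2).

Definition t_velocity k t s := comp G E (theta t s) (derive1 (theta ^~ s) t) k.
Definition s_velocity k t s := comp G E (theta t s) (derive1 (theta t) s) k.

Lemma smooth_on_t_velocity k : smooth_on A (fun ts => t_velocity k ts.1 ts.2).
Proof.
exact: (smooth_on_compf G bE k stheta (smooth_on_derive1_fst stheta)).
Qed.

Lemma smooth_on_s_velocity k : smooth_on A (fun ts => s_velocity k ts.1 ts.2).
Proof.
exact: (smooth_on_compf G bE k stheta (smooth_on_derive1_snd stheta)).
Qed.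

(** This is [structure_equation] in the directions [(1, 0)] and [(0, 1)]. Curried derivatives are
    known to be values of the differential where [theta] is differentiable, that is, near each point
    of [A]; [near_eq_diff] makes the transfer. *)
Lemma derive1_t_velocity k t s : A (t, s) ->
  derive1 (t_velocity k t) s = derive1 (s_velocity k ^~ s) t +
    \sum_i \sum_j t_velocity i t s * s_velocity j t s * struct_const G E k i j.
Proof.
move=> Ats; have dth := smooth_on_near stheta Ats.
pose Th (ts : R * R) := theta ts.1 ts.2.
have tE k' ts : differentiable Th ts ->
    comp G E (Th ts) ('d Th ts (1, 0)) k' = t_velocity k' ts.1 ts.2.
  by case: ts => t' s' d; rewrite /t_velocity derive1_fst deriveE.
have sE k' ts : differentiable Th ts ->
    comp G E (Th ts) ('d Th ts (0, 1)) k' = s_velocity k' ts.1 ts.2.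
  by case: ts => t' s' d; rewrite /s_velocity derive1_snd deriveE.
have seq := @structure_equation _ _ G E bE _ _ _ stheta _ (1, 0) (0, 1) k Ats.
have [D1 e1] := near_eq_diff
   (filterS (fun ts d => tE k ts d) dth)
   (smooth_on_differentiable (smooth_on_compf G bE k stheta
     (smooth_on_diff ((1, 0) : R * R) stheta)) Ats).
have [D2 e2] := near_eq_diff
   (filterS (fun ts d => sE k ts d) dth)
   (smooth_on_differentiable (smooth_on_compf G bE k stheta
     (smooth_on_diff ((0, 1) : R * R) stheta)) Ats).
rewrite derive1_snd derive1_fst (deriveE _ D1) (deriveE _ D2).
have eC : \sum_i \sum_j comp G E (Th (t, s)) ('d Th (t, s) (1, 0)) i *
      comp G E (Th (t, s)) ('d Th (t, s) (0, 1)) j * struct_const G E k i j =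
    \sum_i \sum_j t_velocity i t s * s_velocity j t s * struct_const G E k i j.
  have d := nbhs_singleton dth.
  apply: eq_bigr => i _; apply: eq_bigr => j _.
  by rewrite (tE i (t, s) d) (sE j (t, s) d).
have eB := esym (congr1 (fun h => h (1, 0)) e2).
have eA := congr1 (fun h => h (0, 1)) e1.
exact: (eq_trans eA (eq_trans seq (congr2 (fun x y => x + y) eB eC))).
Qed.

End Velocities.

End FirstVariation.

Lemma is_diff_sqrt (R : realType) (x : R) : 0 < x ->
  is_diff x (@Num.sqrt R) (fun v => v * (2 * Num.sqrt x)^-1).
Proof.
move=> x0; have [ds es] := is_derive1_sqrt x0.
have D : differentiable (@Num.sqrt R) x by exact/derivable1_diffP.
split=> //; apply/funext => v.
by rewrite [LHS](congr1 (fun h => h v) (diff1E D)) derive1E es.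
Qed.

(** * The integrand along a variation of a horizontal path *)

Section HorizontalVariation.
Variables (R : realType) (n : nat) (G : carnotGroup R n) (E : n.-tuple 'rV[R]_n).
Hypothesis hE : adapted_frame G E.
Local Notation T := 'rV[R]_n.
Let bE : basis_of fullv E. Proof. by case: hE. Qed.
Variables (a b : R) (x : R -> T) (theta : R -> R -> T) (P : 'I_n -> R -> R -> R).
Hypothesis ab : a < b.
Hypothesis sx : smooth_on `[a, b] x.
Hypothesis hreg : forall t, t \in `[a, b]%R -> derive1 x t != 0.
Hypothesis hhor : horizontal_on G E a b x.
Local Notation strip0 := (`[a, b] `*` [set 0 : R]).
Hypothesis stheta : smooth_on strip0 (fun ts => theta ts.1 ts.2).
Hypothesis theta0 : forall t, t \in `[a, b]%R -> theta t 0 = x t.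
Hypothesis sP : forall i : 'I_n, (hdim G <= i)%N ->
  smooth_on strip0 (fun ts => P i ts.1 ts.2).
Local Notation t_velocity := (t_velocity G E theta).
Local Notation s_velocity := (s_velocity G E theta).

Definition velocity k t := comp G E (x t) (derive1 x t) k.
Definition speed t := rnorm G E (x t) (derive1 x t).
Definition horizontal_speed t s :=
  Num.sqrt (\sum_(k < n | (k < hdim G)%N) t_velocity k t s * t_velocity k t s).
Definition lagrangian t s :=
  horizontal_speed t s + \sum_(k < n | (hdim G <= k)%N) P k t s * t_velocity k t s.

Lemma velocity_vertical (k : 'I_n) t :
  t \in `[a, b]%R -> (hdim G <= k)%N -> velocity k t = 0.
Proof.
move=> tab hk; rewrite /velocity -hhor// comp_hproj//.
by rewrite ltnNge hk.
Qed.

Lemma smooth_on_velocity k : smooth_on `[a, b] (velocity k).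
Proof. exact: (smooth_on_compf G bE k sx (smooth_on_derive1 sx)). Qed.

Lemma speedE t : speed t = Num.sqrt (\sum_k velocity k t * velocity k t).
Proof. by []. Qed.

Lemma velocity_sqr_gt0 t : t \in `[a, b]%R -> 0 < \sum_k velocity k t * velocity k t.
Proof.
move=> tab; rewrite lt_def sumr_ge0 ?andbT => [|k _]; last by rewrite -expr2 sqr_ge0.
apply: contra (hreg tab) => /eqP.
move=> /psumr_eq0P h; apply/eqP/(@comp_ext _ _ G E bE (x t)) => k; rewrite comp0.
apply/eqP; rewrite -[_ == 0]orbb -mulf_eq0; apply/eqP.
by apply: h => // k' _; rewrite -expr2 sqr_ge0.
Qed.

Lemma speed_gt0 t : t \in `[a, b]%R -> 0 < speed t.
Proof. by move=> tab; rewrite speedE sqrtr_gt0 velocity_sqr_gt0. Qed.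

Lemma smooth_on_speed : smooth_on `[a, b] speed.
Proof.
apply: smooth_on_sqrt => [t|]; first exact: velocity_sqr_gt0.
by apply: smooth_on_sum => k _; apply: smooth_onM; exact: smooth_on_velocity.
Qed.

(** Since [theta ^~ 0] and [x] agree on [[a, b]] only, the endpoints require [derive1_eq_itv]. *)
Lemma t_velocity0 k t : t \in `[a, b]%R -> t_velocity k t 0 = velocity k t.
Proof.
move=> tab; rewrite /velocity /t_velocity theta0//; congr (comp _ _ _ _ _).
have sth : smooth_on `[a, b] (theta ^~ 0).
  by apply: (smooth_on_slicel (f := fun ts => theta ts.1 ts.2)) stheta.
apply: (derive1_eq_itv ab tab); last exact: theta0.
- exact/diff_derivable/(smooth_on_differentiable sth).
- exact/diff_derivable/(smooth_on_differentiable sx).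
Qed.

Lemma horizontal_sum t (F : 'I_n -> R) : t \in `[a, b]%R ->
  \sum_(k < n | (k < hdim G)%N) velocity k t * F k = \sum_k velocity k t * F k.
Proof.
move=> tab; rewrite [LHS]big_mkcond; apply: eq_bigr => k _.
by case: ltnP => // hk; rewrite velocity_vertical// mul0r.
Qed.

Lemma horizontal_speed0 t : t \in `[a, b]%R -> horizontal_speed t 0 = speed t.
Proof.
move=> tab; rewrite /horizontal_speed; under eq_bigr do rewrite t_velocity0//.
by rewrite horizontal_sum.
Qed.

(** At [s = 0] the quantity under the root is the squared speed of [x], by horizontality, and it is
    positive by regularity. *)
Lemma smooth_on_horizontal_speed :
  smooth_on strip0 (fun ts => horizontal_speed ts.1 ts.2).
Proof.
apply: smooth_on_sqrt => [[t s] /= [tab ->]|].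
  rewrite -sqrtr_gt0 -/(horizontal_speed t 0) horizontal_speed0//; exact: speed_gt0.
apply: smooth_on_sum => k _.
by apply: smooth_onM; exact: (smooth_on_t_velocity hE stheta).
Qed.

Lemma smooth_on_lagrangian : smooth_on strip0 (fun ts => lagrangian ts.1 ts.2).
Proof.
apply: smooth_onD; first exact: smooth_on_horizontal_speed.
apply: smooth_on_sum => k hk; apply: smooth_onM; first exact: sP.
exact: (smooth_on_t_velocity hE stheta).
Qed.

Lemma I_SR_lagrangian s : I_SR G E a b (theta ^~ s) (fun i t => P i t s) =
  \int[lebesgue_measure]_(t in `[a, b]) lagrangian t s.
Proof.
apply: eq_Rintegral => t _; congr (_ + _).
  rewrite /rnorm /horizontal_speed /metric [in RHS]big_mkcond; congr Num.sqrt.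
  by apply: eq_bigr => k _; rewrite comp_hproj//; case: ifP => //; rewrite mul0r.
rewrite /metric [in RHS]big_mkcond; apply: eq_bigr => k _.
by rewrite comp_vfield//; case: ifP => // _; rewrite mul0r.
Qed.

Lemma derive1_horizontal_speed t : t \in `[a, b]%R -> derive1 (horizontal_speed t) 0 =
  \sum_k (speed t)^-1 * velocity k t * derive1 (t_velocity k t) 0.
Proof.
move=> tab.
have dtv k : is_diff (0 : R) (t_velocity k t) ('d (t_velocity k t) (0 : R)).
  apply/differentiableP/derivable1_diffP; apply: derivable_snd.
  by apply: (smooth_on_differentiable (smooth_on_t_velocity hE stheta k)).
have := is_diff_bigsum (fun k : 'I_n => (k < hdim G)%N)
  (fun k => is_diff_mul (dtv k) (dtv k)).
set Q := fun s : R => _.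
have Q0 : Q 0 = \sum_k velocity k t * velocity k t.
  by rewrite /Q; under eq_bigr do rewrite t_velocity0//; rewrite horizontal_sum.
move=> dQ; have Qgt0 : 0 < Q 0 by rewrite Q0 velocity_sqr_gt0.
have [D e] := is_diff_comp dQ (is_diff_sqrt Qgt0).
apply: (eq_trans (derive1E' D)).
apply: (eq_trans (congr1 (fun h => h 1) e)) => /=.
rewrite Q0 -speedE.
have de k : 'd (t_velocity k t) (0 : R) (1 : R) = derive1 (t_velocity k t) 0.
  by apply: esym; apply: derive1E'; case: (dtv k).
rewrite (eq_bigr (fun k => velocity k t * (2 * derive1 (t_velocity k t) 0))); last first.
  by move=> k _; rewrite t_velocity0// de [_ * velocity k t]mulrC -mulrDr mulr_natl.
rewrite horizontal_sum// mulr_suml; apply: eq_bigr => k _.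
rewrite [2 * derive1 (t_velocity k t) 0]mulrC invfM !mulrA mulfK ?pnatr_eq0//.
by rewrite [LHS]mulrC mulrA.
Qed.

Lemma derive1_lagrangian t : t \in `[a, b]%R -> derive1 (lagrangian t) 0 =
  \sum_k (speed t)^-1 * velocity k t * derive1 (s_velocity k ^~ 0) t +
  \sum_(k < n | (hdim G <= k)%N) P k t 0 * (derive1 (s_velocity k ^~ 0) t +
     \sum_i \sum_j velocity i t * s_velocity j t 0 * struct_const G E k i j).
Proof.
move=> tab.
have dtv k : is_diff (0 : R) (t_velocity k t) ('d (t_velocity k t) (0 : R)).
  apply/differentiableP/derivable1_diffP; apply: derivable_snd.
  by apply: (smooth_on_differentiable (smooth_on_t_velocity hE stheta k)).
have dh : is_diff (0 : R) (horizontal_speed t) ('d (horizontal_speed t) (0 : R)).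
  apply/differentiableP/derivable1_diffP; apply: derivable_snd.
  by apply: (smooth_on_differentiable smooth_on_horizontal_speed).
(* [is_diff_bigsum] wants every family member differentiable, even outside the range of the sum,
   whereas [P] is smooth for vertical indices only; hence the extension by zero. *)
pose Pv (k : 'I_n) s := if (hdim G <= k)%N then P k t s else 0.
have dP k : is_diff (0 : R) (Pv k) ('d (Pv k) (0 : R)).
  apply/differentiableP; have [hk|hk] := boolP (hdim G <= k)%N; last first.
    have -> : Pv k = cst 0 by apply/funext => s; rewrite /Pv (negbTE hk).
    exact: differentiable_cst.
  have -> : Pv k = P k t by apply/funext => s; rewrite /Pv hk.
  apply/derivable1_diffP; apply: derivable_snd.
  by apply: (smooth_on_differentiable (sP hk)).
have [D e] : is_diff (0 : R) (lagrangian t) (fun v =>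
    'd (horizontal_speed t) (0 : R) v +
    \sum_(k < n | (hdim G <= k)%N)
      (Pv k 0 * 'd (t_velocity k t) (0 : R) v +
       'd (Pv k) (0 : R) v * t_velocity k t 0)).
  apply: eq_is_diff (is_diffD dh (is_diff_bigsum (fun k : 'I_n => (hdim G <= k)%N)
    (fun k => is_diff_mul (dP k) (dtv k)))) => // s.
  by congr (_ + _); apply: eq_bigr => k hk; rewrite /Pv hk.
apply: (eq_trans (derive1E' D)).
apply: (eq_trans (congr1 (fun h => h 1) e)).
have A0 : strip0 (t, 0) by [].
have de k : 'd (t_velocity k t) (0 : R) (1 : R) = derive1 (s_velocity k ^~ 0) t +
     \sum_i \sum_j velocity i t * s_velocity j t 0 * struct_const G E k i j.
  transitivity (derive1 (t_velocity k t) 0).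
    by apply: esym; apply: derive1E'; case: (dtv k).
  rewrite (derive1_t_velocity hE stheta k A0); congr (_ + _).
  by apply: eq_bigr => i _; apply: eq_bigr => j _; rewrite (t_velocity0 i tab).
have eH : 'd (horizontal_speed t) (0 : R) (1 : R) =
    \sum_k (speed t)^-1 * velocity k t * derive1 (s_velocity k ^~ 0) t.
  transitivity (derive1 (horizontal_speed t) 0).
    by apply: esym; apply: derive1E'; case: dh.
  rewrite (derive1_horizontal_speed tab); apply: eq_bigr => k _.
  have z (c d1 d2 : R) : c = 0 -> (speed t)^-1 * c * d1 = (speed t)^-1 * c * d2.
    by move=> ->; rewrite mulr0 !mul0r.
  (* For vertical [k] the coefficient [velocity k t] vanishes. For horizontal [k] each term of the
     bracket sum has a zero factor: the velocity if [i] is vertical, the structure constant if [i]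
     is horizontal. *)
  have [hk|hk] := ltnP k (hdim G); last exact: z (velocity_vertical tab hk).
  have z2 (d c : R) : c = 0 -> d + c = d by move=> ->; rewrite addr0.
  apply: (congr1 (fun d => (speed t)^-1 * velocity k t * d)
    (eq_trans (derive1_t_velocity hE stheta k A0) (z2 _ _ _))).
  rewrite big1// => i _; rewrite big1// => j _; rewrite (t_velocity0 i tab).
  have [hi|hi] := ltnP i (hdim G); last by rewrite (velocity_vertical tab hi) !mul0r.
  by rewrite (struct_const_horizontal hE j hk hi) mulr0.
have eS : \sum_(k < n | (hdim G <= k)%N)
     (Pv k 0 * 'd (t_velocity k t) (0 : R) (1 : R) +
      'd (Pv k) (0 : R) (1 : R) * t_velocity k t 0) =
    \sum_(k < n | (hdim G <= k)%N) P k t 0 * (derive1 (s_velocity k ^~ 0) t +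
      \sum_i \sum_j velocity i t * s_velocity j t 0 * struct_const G E k i j).
  (* The [s]-derivative of the multiplier meets a vertical component of [x'], which is zero. *)
  apply: eq_bigr => k hk; rewrite (t_velocity0 k tab) (velocity_vertical tab hk) /Pv hk.
  have z (c d1 d2 d3 : R) : d1 = d2 -> c * d1 + d3 * 0 = c * d2.
    by move=> ->; rewrite mulr0 addr0.
  exact: z (de k).
exact: (congr2 (fun x y => x + y) eH eS).
Qed.

End HorizontalVariation.

(** Pointwise integration by parts as an identity of finite sums: the first bracket on the right is
    the derivative of the boundary term, the last sum the pairing of [Y] with the Euler-Lagrange
    expression. The sign of the [C(P_V)] term comes from exchanging the lower indices of [C]. *)
Lemma first_variation_sum (R : comPzRingType) n (h : pred 'I_n) (s : R)
    (p y d dtau P dP : 'I_n -> R) (C : 'I_n -> 'I_n -> 'I_n -> R) :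
  (forall k i j, C k i j = - C k j i) ->
  \sum_k s * p k * d k +
    \sum_(k < n | h k) P k * (d k + \sum_i \sum_j p i * y j * C k i j) =
  (\sum_k (y k * dtau k + d k * (s * p k)) +
   \sum_(k < n | h k) (y k * dP k + d k * P k)) -
  \sum_k y k * (dtau k + (if h k then dP k else 0) +
                \sum_j (\sum_(al < n | h al) P al * C al k j) * p j).
Proof.
move=> antiC.
have e : \sum_k y k * \sum_j (\sum_(al < n | h al) P al * C al k j) * p j =
    - \sum_(k < n | h k) P k * \sum_i \sum_j p i * y j * C k i j.
  under eq_bigr do rewrite mulr_sumr.
  under eq_bigr do under eq_bigr do rewrite mulr_suml mulr_sumr.
  rewrite exchange_big /=; under eq_bigr do rewrite exchange_big /=.
  rewrite exchange_big /= -sumrN; apply: eq_bigr => al _.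
  rewrite mulr_sumr -sumrN; apply: eq_bigr => i _.
  rewrite mulr_sumr -sumrN; apply: eq_bigr => j _.
  by rewrite (antiC al i j) mulrN mulrN opprK; ring.
have -> : \sum_k y k * (dtau k + (if h k then dP k else 0) +
    \sum_j (\sum_(al < n | h al) P al * C al k j) * p j) =
    \sum_k y k * dtau k + \sum_(k < n | h k) y k * dP k -
    \sum_(k < n | h k) P k * \sum_i \sum_j p i * y j * C k i j.
  rewrite -e [\sum_(k < n | h k) _]big_mkcond -!big_split /=; apply: eq_bigr => k _.
  by rewrite !mulrDr; case: ifP => // _; rewrite mulr0.
under [X in _ + X = _]eq_bigr do rewrite mulrDr.
rewrite !big_split /=.
rewrite (eq_bigr (fun k => d k * (s * p k))); last by move=> k _; rewrite mulrC.
rewrite [\sum_(i < n | h i) P i * d i](eq_bigr (fun k => d k * P k)); last first.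
  by move=> k _; rewrite mulrC.
by ring.
Qed.

(** * Pointwise integration by parts *)

Section BoundaryTerm.
Variables (R : realType) (n : nat) (G : carnotGroup R n) (E : n.-tuple 'rV[R]_n).
Hypothesis hE : adapted_frame G E.
Local Notation T := 'rV[R]_n.
Let bE : basis_of fullv E. Proof. by case: hE. Qed.
Variable nabla : (T -> T) -> (T -> T) -> (T -> T).
Hypothesis hnabla : levi_civita G E nabla.
Variables (a b : R) (x : R -> T) (theta : R -> R -> T) (P : 'I_n -> R -> R -> R).
Hypothesis ab : a < b.
Hypothesis sx : smooth_on `[a, b] x.
Hypothesis hreg : forall t, t \in `[a, b]%R -> derive1 x t != 0.
Hypothesis hhor : horizontal_on G E a b x.
Local Notation strip0 := (`[a, b] `*` [set 0 : R]).
Hypothesis stheta : smooth_on strip0 (fun ts => theta ts.1 ts.2).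
Hypothesis theta0 : forall t, t \in `[a, b]%R -> theta t 0 = x t.
Hypothesis sP : forall i : 'I_n, (hdim G <= i)%N ->
  smooth_on strip0 (fun ts => P i ts.1 ts.2).
Local Notation s_velocity := (s_velocity G E theta).
Local Notation velocity := (velocity G E x).
Local Notation speed := (speed G E x).
Local Notation lagrangian := (lagrangian G E theta P).

Definition tangent_coef k t := (speed t)^-1 * velocity k t.

(** The pairing of [Y] with [x'/|x'| + P_V] in components. Components of [Y] are taken at
    [theta t 0] and those of the tangent at [x t], so it is this pairing on [[a, b]], where the two
    points coincide. *)
Definition boundary_term t := \sum_k s_velocity k t 0 * tangent_coef k t +
  \sum_(k < n | (hdim G <= k)%N) s_velocity k t 0 * P k t 0.

Lemma smooth_on_tangent_coef k : smooth_on `[a, b] (tangent_coef k).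
Proof.
apply: (smooth_onM (smooth_onV _ (smooth_on_speed hE sx hreg))
  (smooth_on_velocity hE sx k)).
by move=> t tab; rewrite gt_eqF// (speed_gt0 hE hreg).
Qed.

Lemma smooth_on_s_velocity0 k : smooth_on `[a, b] (s_velocity k ^~ 0).
Proof.
by apply: (smooth_on_slicel (f := fun ts => s_velocity k ts.1 ts.2))
  (smooth_on_s_velocity hE stheta k).
Qed.

Lemma smooth_on_P0 (k : 'I_n) : (hdim G <= k)%N -> smooth_on `[a, b] (P k ^~ 0).
Proof.
by move=> hk; apply: (smooth_on_slicel (f := fun ts => P k ts.1 ts.2)) (sP hk).
Qed.

Lemma smooth_on_boundary_term : smooth_on `[a, b] boundary_term.
Proof.
apply: smooth_onD; apply: smooth_on_sum => k hk; apply: smooth_onM.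
- exact: smooth_on_s_velocity0.
- exact: smooth_on_tangent_coef.
- exact: smooth_on_s_velocity0.
- exact: smooth_on_P0.
Qed.

Lemma derive1_boundary_term t : t \in `[a, b]%R -> derive1 boundary_term t =
  \sum_k (s_velocity k t 0 * derive1 (tangent_coef k) t +
          derive1 (s_velocity k ^~ 0) t * tangent_coef k t) +
  \sum_(k < n | (hdim G <= k)%N)
     (s_velocity k t 0 * derive1 (P k ^~ 0) t +
      derive1 (s_velocity k ^~ 0) t * P k t 0).
Proof.
move=> tab.
have dd (f : R -> R) : smooth_on `[a, b] f -> is_diff t f (fun v => v * derive1 f t).
  move=> sf; have D := smooth_on_differentiable sf tab.
  by split=> //; exact: diff1E.
pose Pv (k : 'I_n) s := if (hdim G <= k)%N then P k s 0 else 0.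
have sPv k : smooth_on `[a, b] (Pv k).
  have [hk|hk] := boolP (hdim G <= k)%N; last first.
    have -> : Pv k = cst 0 by apply/funext => s; rewrite /Pv (negbTE hk).
    exact: (@smooth_on_cst _ _ R).
  have -> : Pv k = P k ^~ 0 by apply/funext => s; rewrite /Pv hk.
  exact: smooth_on_P0.
have [D e] : is_diff t boundary_term (fun v =>
    \sum_k (s_velocity k t 0 * (v * derive1 (tangent_coef k) t) +
            v * derive1 (s_velocity k ^~ 0) t * tangent_coef k t) +
    \sum_(k < n | (hdim G <= k)%N) (s_velocity k t 0 * (v * derive1 (Pv k) t) +
            v * derive1 (s_velocity k ^~ 0) t * Pv k t)).
  apply: eq_is_diff (is_diffD
    (is_diff_bigsum xpredT (fun k => is_diff_mul (dd _ (smooth_on_s_velocity0 k))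
       (dd _ (smooth_on_tangent_coef k))))
    (is_diff_bigsum (fun k : 'I_n => (hdim G <= k)%N) (fun k => is_diff_mul
       (dd _ (smooth_on_s_velocity0 k)) (dd _ (sPv k))))) => // s.
  by congr (_ + _); apply: eq_bigr => k hk; rewrite /Pv hk.
apply: (eq_trans (derive1E' D)).
apply: (eq_trans (congr1 (fun h => h 1) e)).
have z (A B C D' : R) : A * (1 * B) + 1 * C * D' = A * B + C * D' by rewrite !mul1r.
apply: (congr2 (fun x y => x + y)); apply: eq_bigr => k hk.
  exact: z.
apply: (eq_trans (z _ _ _ _)).
have -> : Pv k = P k ^~ 0 by apply/funext => s; rewrite /Pv hk.
by [].
Qed.

Lemma comp_s_velocity t k : t \in `[a, b]%R ->
  comp G E (x t) (derive1 (theta t) 0) k = s_velocity k t 0.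
Proof. by move=> tab; rewrite /s_velocity theta0. Qed.

Lemma comp_unit_tangent t k :
  comp G E (x t) (unit_tangent G E x t) k = tangent_coef k t.
Proof. exact: compZ. Qed.

Lemma boundary_termE t : t \in `[a, b]%R ->
  metric G E (x t) (derive1 (theta t) 0)
    (unit_tangent G E x t + vfield G E (fun i => P i t 0) (x t)) = boundary_term t.
Proof.
move=> tab; rewrite /boundary_term [X in _ = _ + X]big_mkcond -big_split /=.
apply: eq_bigr => k _; rewrite compD comp_vfield// comp_unit_tangent comp_s_velocity//.
by rewrite mulrDr; case: ifP => // _; rewrite mulr0.
Qed.

Lemma differentiable_unit_tangent t : t \in `[a, b]%R ->
  differentiable (unit_tangent G E x) t.
Proof.
move=> tab.
have s : smooth_on `[a, b] (unit_tangent G E x).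
  apply: (smooth_onZ (smooth_onV _ (smooth_on_speed hE sx hreg))
    (smooth_on_derive1 sx)).
  by move=> s sab; rewrite gt_eqF// (speed_gt0 hE hreg).
exact: smooth_on_differentiable s tab.
Qed.

Lemma comp_cov_deriv_tangent t k : t \in `[a, b]%R ->
  comp G E (x t) (cov_deriv nabla x (unit_tangent G E x) t) k =
  derive1 (tangent_coef k) t.
Proof.
move=> tab.
have dx := smooth_on_differentiable sx tab.
apply: (eq_trans (comp_cov_deriv hE hnabla k dx (differentiable_unit_tangent tab))).
have -> : (fun s => comp G E (x s) (unit_tangent G E x s) k) = tangent_coef k.
  by apply/funext => s; rewrite comp_unit_tangent.
have z (c d : R) : c = 0 -> d + c = d by move=> ->; rewrite addr0.
apply: z.
have ch := christoffel_horizontal hE hnabla (x t) (a := velocity ^~ t) k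
  (fun i => velocity_vertical hE hhor tab).
transitivity ((speed t)^-1 * \sum_i \sum_j velocity i t * velocity j t *
    christoffel G E nabla (x t) j i k); last by rewrite ch mulr0.
rewrite mulr_sumr; apply: eq_bigr => i _; rewrite mulr_sumr; apply: eq_bigr => j _.
by rewrite comp_unit_tangent /tangent_coef !mulrA.
Qed.

(** Orthogonality removes the [Q_V] term; the rest is [first_variation_sum] read in components. On
    the right stands a total [t]-derivative, which integrates to the boundary values, minus the
    integrand of the first variation. *)
Lemma euler_lagrangeE t : t \in `[a, b]%R ->
  metric G E (x t) (derive1 (theta t) 0)
    (cov_deriv nabla x (unit_tangent G E x) t +
     vfield G E (fun i => derive1 (P i ^~ 0) t) (x t) +
     Cact G E (fun i => P i t 0) (x t) (derive1 x t)) -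
  metric G E (x t) (vfield G E (fun i => derive1 (P i t) 0) (x t)) (derive1 x t) =
  derive1 boundary_term t - derive1 (lagrangian t) 0.
Proof.
move=> tab.
have -> : metric G E (x t) (vfield G E (fun i => derive1 (P i t) 0) (x t))
    (derive1 x t) = 0.
  rewrite /metric big1// => k _; rewrite comp_vfield//.
  case: ifP => hk; last by rewrite mul0r.
  by rewrite -/(velocity k t) (velocity_vertical hE hhor tab hk) mulr0.
have gen (A B C : R) : C = B - A -> A - 0 = B - C.
  by move=> ->; rewrite subr0 opprB addrC subrK.
apply: gen.
apply: (eq_trans (derive1_lagrangian hE ab sx hreg hhor stheta theta0 sP tab)).
rewrite (derive1_boundary_term tab).
apply: (eq_trans (first_variation_sum _ _ _ _ _ (fun k => derive1 (tangent_coef k) t) _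
  (fun k => derive1 (P k ^~ 0) t) (struct_constC G bE))).
congr (_ - _); apply: eq_bigr => k _.
rewrite (comp_s_velocity k tab) 2!compD (comp_cov_deriv_tangent k tab).
by rewrite (comp_vfield G bE) (comp_Cact G bE).
Qed.

End BoundaryTerm.

(** * Passage to the integral *)

Section FirstVariationIntegral.
Variables (R : realType) (n : nat) (G : carnotGroup R n) (E : n.-tuple 'rV[R]_n).
Hypothesis hE : adapted_frame G E.
Local Notation T := 'rV[R]_n.
Local Notation mu := (@lebesgue_measure R).
Variables (a b : R) (x : R -> T) (theta : R -> R -> T) (P : 'I_n -> R -> R -> R).
Hypothesis ab : a < b.
Hypothesis sx : smooth_on `[a, b] x.
Hypothesis hreg : forall t, t \in `[a, b]%R -> derive1 x t != 0.
Hypothesis hhor : horizontal_on G E a b x.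
Local Notation strip0 := (`[a, b] `*` [set 0 : R]).
Hypothesis stheta : smooth_on strip0 (fun ts => theta ts.1 ts.2).
Hypothesis theta0 : forall t, t \in `[a, b]%R -> theta t 0 = x t.
Hypothesis sP : forall i : 'I_n, (hdim G <= i)%N ->
  smooth_on strip0 (fun ts => P i ts.1 ts.2).
Local Notation lagr := (lagrangian G E theta P).
Local Notation boundary_term := (boundary_term G E x theta P).

Lemma is_derive_I_SR :
  is_derive (0 : R) (1 : R)
    (fun s => I_SR G E a b (theta ^~ s) (fun i t => P i t s))
    (\int[mu]_(t in `[a, b]) derive1 (lagr t) 0).
Proof.
rewrite (_ : (fun s => _) = fun s => \int[mu]_(t in `[a, b]) lagr t s); last first.
  by apply/funext => s; rewrite (I_SR_lagrangian hE).
apply: is_derive_Rintegral.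
exact: (smooth_on_lagrangian hE ab sx hreg hhor stheta theta0 sP).
Qed.

Lemma integrable_derive1_lagrangian :
  mu.-integrable `[a, b] (EFin \o (fun t => derive1 (lagr t) 0)).
Proof.
apply: smooth_on_integrable.
have sl := smooth_on_lagrangian hE ab sx hreg hhor stheta theta0 sP.
by apply: (smooth_on_slicel (f := fun ts => derive1 (lagr ts.1) ts.2))
  (smooth_on_derive1_snd sl).
Qed.

Lemma integrable_derive1_boundary_term :
  mu.-integrable `[a, b] (EFin \o derive1 boundary_term).
Proof.
apply/smooth_on_integrable/smooth_on_derive1.
exact: (smooth_on_boundary_term hE sx hreg stheta sP).
Qed.

Lemma integral_derive1_boundary_term :
  \int[mu]_(t in `[a, b]) derive1 boundary_term t = boundary_term b - boundary_term a.
Proof. exact/smooth_on_FTC2/(smooth_on_boundary_term hE sx hreg stheta sP). Qed.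

End FirstVariationIntegral.

Theorem proposition2p13 (R : realType) (n : nat) (G : carnotGroup R n)
    (E : n.-tuple 'rV[R]_n) (hE : adapted_frame G E)
    (nabla : ('rV[R]_n -> 'rV[R]_n) -> ('rV[R]_n -> 'rV[R]_n) ->
             ('rV[R]_n -> 'rV[R]_n))
    (hnabla : levi_civita G E nabla)
    (a b eps : R) (hab : a < b) (heps : 0 < eps)
    (x : R -> 'rV[R]_n) (hx : smooth_on `[a, b] x)
    (hreg : forall t, t \in `[a, b]%R -> derive1 x t != 0)
    (hhor : horizontal_on G E a b x)
    (theta : R -> R -> 'rV[R]_n) (htheta : variation a b eps x theta)
    (P : 'I_n -> R -> R -> R)
    (hP : forall i : 'I_n, (hdim G <= i)%N ->
      smooth_on (strip a b eps) (fun ts => P i ts.1 ts.2)) :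
  let metr t := metric G E (x t) in
  let ISR s := I_SR G E a b (theta ^~ s) (fun i t => P i t s) in
  let Y t := derive1 (theta t) 0 in
  let PV t := vfield G E (fun i => P i t 0) (x t) in
  let dtPV t := vfield G E (fun i => derive1 (P i ^~ 0) t) (x t) in
  let QV t := vfield G E (fun i => derive1 (P i t) 0) (x t) in
  let CP t := Cact G E (fun i => P i t 0) (x t) (derive1 x t) in
  let tau := unit_tangent G E x in
  let bdry t := metr t (Y t) (tau t + PV t) in
  is_derive (0 : R) (1 : R) ISR
    (bdry b - bdry a -
     \int[lebesgue_measure]_(t in `[a, b])
       (metr t (Y t) (cov_deriv nabla x tau t + dtPV t + CP t) -
        metr t (QV t) (derive1 x t)))
  /\
  ((forall t, t \in `[a, b]%R -> rnorm G E (x t) (derive1 x t) = 1) ->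
   homotopy_of a b eps x theta ->
   is_derive (0 : R) (1 : R) ISR
     (\int[lebesgue_measure]_(t in `[a, b])
       (metr t (QV t) (derive1 x t) -
        metr t (Y t) (cov_deriv nabla x (derive1 x) t + dtPV t + CP t)))).
Proof.
move=> metr ISR Y PV dtPV QV CP tau bdry.
have [sth theta0] := htheta.
(* A derivative at [s = 0] uses the variation near this segment only. *)
have sub : `[a, b] `*` [set 0 : R] `<=` strip a b eps.
  by move=> [t s] /= [tab ->]; split=> //=; rewrite in_itv/= oppr_lt0 heps.
have stheta := smooth_on_subset sub sth.
have sP (i : 'I_n) (hi : (hdim G <= i)%N) := smooth_on_subset sub (hP i hi).
have dI := is_derive_I_SR hE hab hx hreg hhor stheta theta0 sP.
have iL := integrable_derive1_lagrangian hE hab hx hreg hhor stheta theta0 sP.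
have iB := integrable_derive1_boundary_term hE hx hreg stheta sP.
have eB := integral_derive1_boundary_term hE hab hx hreg stheta sP.
have aab : a \in `[a, b]%R by rewrite in_itv/= lexx ltW.
have bab : b \in `[a, b]%R by rewrite in_itv/= lexx ltW.
have bE t : t \in `[a, b]%R -> bdry t = boundary_term G E x theta P t.
  exact: (boundary_termE hE P theta0).
have EL t (tab : t \in `[a, b]%R) :=
  euler_lagrangeE hE hnabla hab hx hreg hhor stheta theta0 sP tab.
split.
  have -> : \int[lebesgue_measure]_(t in `[a, b])
      (metr t (Y t) (cov_deriv nabla x tau t + dtPV t + CP t) -
       metr t (QV t) (derive1 x t)) =
      \int[lebesgue_measure]_(t in `[a, b]) (derive1 (boundary_term G E x theta P) t -
        derive1 (lagrangian G E theta P t) 0).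
    by apply: eq_Rintegral => t /set_mem tab; exact: EL.
  rewrite RintegralB// eB !bE//.
  by rewrite opprB addrC subrK.
move=> unit_speed [_ fixed_ends].
(* Where an endpoint is fixed, [theta t] is constant near [s = 0], so [Y] vanishes there. *)
have boundary_term0 t : t \in `[a, b]%R ->
    (forall s, s \in `]- eps, eps[%R -> theta t s = x t) ->
    boundary_term G E x theta P t = 0.
  move=> tab th; have Yt : Y t = 0.
    rewrite /Y -(derive1_cst (x t) (0 : R)) !derive1E.
    apply: near_eq_derive.
    have : (0 : R) \in `]- eps, eps[%R by rewrite in_itv/= oppr_lt0 heps.
    by move=> /near_in_itvoo; apply: filterS => s; exact: th.
  rewrite -bE// /bdry Yt /metr /metric big1// => k _.
  by rewrite comp0 mul0r.
have tauE s : s \in `[a, b]%R -> tau s = derive1 x s.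
  by move=> sab; rewrite /tau /unit_tangent unit_speed// invr1 scale1r.
(* Unit speed holds on [[a, b]] only, so the derivatives of [tau] and [x'] are again compared
   through one-sided limits. *)
have covE t : t \in `[a, b]%R ->
    cov_deriv nabla x (derive1 x) t = cov_deriv nabla x tau t.
  move=> tab; rewrite /cov_deriv tauE//; congr (_ + _); apply: esym.
  apply: (derive1_eq_itv hab tab) => //; apply: diff_derivable.
    exact: (differentiable_unit_tangent hE hx hreg).
  exact: smooth_on_differentiable (smooth_on_derive1 hx) _.
have -> : \int[lebesgue_measure]_(t in `[a, b])
    (metr t (QV t) (derive1 x t) -
     metr t (Y t) (cov_deriv nabla x (derive1 x) t + dtPV t + CP t)) =
    \int[lebesgue_measure]_(t in `[a, b]) (derive1 (lagrangian G E theta P t) 0 -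
      derive1 (boundary_term G E x theta P) t).
  apply: eq_Rintegral => t /set_mem tab; rewrite covE//.
  by rewrite -[LHS]opprB -[RHS]opprB; congr (- _); exact: EL.
rewrite RintegralB// eB !boundary_term0//.
- by rewrite !subr0.
- by move=> s sab; have [] := fixed_ends s sab.
- by move=> s sab; have [] := fixed_ends s sab.
Qed.
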